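(* Let $m,n$ be positive integers and let $G=\mathbb{Z}_m\times\mathbb{Z}_n$. Then any monoidal structure on the linear Gr-category over $G$ is tensor equivalent to $\operatorname{Vec}_G^{\Phi_{a,b,d}}$ for some $a\in\{0,\ldots,m-1\}$, $b\in\{0,\ldots,(m,n)-1\}$ and $d\in\{0,\ldots,n-1\}$.
   Context: Throughout, $k$ is an algebraically closed field of characteristic zero and $k^*=k\setminus\{0\}$. $(m,n)$ denotes the greatest common divisor of $m$ and $n$; $[x]$ denotes the integer part (floor) of a rational number $x$; for each natural number $s$, $\zeta_s\in k$ is a fixed primitive $s$-th root of unity. $g_1$ (resp. $g_2$) is a generator of $\mathbb{Z}_m$ (resp. $\mathbb{Z}_n$), with groups written multiplicatively. A normalized $3$-cocycle on a group $G$ (coefficients in $k^*$ with trivial action) is a map $\Phi:G^3\to k^*$ with $\Phi(y,z,w)\Phi(x,yz,w)\Phi(x,y,z)=\Phi(xy,z,w)\Phi(x,y,zw)$ for all $x,y,z,w\in G$, and with value $1$ whenever one of its arguments is the identity. For $0\le a<m$, $0\le b<(m,n)$, $0\le d<n$, $\Phi_{a,b,d}$ is the normalized $3$-cocycle on $\mathbb{Z}_m\times\mathbb{Z}_n$ given by $$\Phi_{a,b,d}(g_1^ig_2^j,\,g_1^sg_2^t,\,g_1^kg_2^l)=\zeta_m^{a[\frac{k+s}{m}]i}\,\zeta_n^{b[\frac{k+s}{m}]j}\,\zeta_n^{d[\frac{t+l}{n}]j},\qquad 0\le i,s,k<m,\ 0\le j,t,l<n.$$ $\operatorname{Vec}_G$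 is the category of finite-dimensional $G$-graded $k$-vector spaces with tensor product $(V\otimes W)_g=\bigoplus_{x,y\in G,\,xy=g}V_x\otimes W_y$; the linear Gr-category over $G$ is $(\operatorname{Vec}_G,\otimes)$. Monoidal structures on $(\operatorname{Vec}_G,\otimes)$ are parameterized by the normalized $3$-cocycles $\Phi$ on $G$: $\operatorname{Vec}_G^{\Phi}$ denotes the monoidal category whose associativity constraint $(U\otimes V)\otimes W\to U\otimes(V\otimes W)$ is $(u\otimes v)\otimes w\mapsto\Phi(x,y,z)\,u\otimes(v\otimes w)$ for $u\in U_x$, $v\in V_y$, $w\in W_z$, with the usual unit constraints. A monoidal structure on the linear Gr-category over $G$ means $\operatorname{Vec}_G^{\Phi}$ for some normalized $3$-cocycle $\Phi$. Tensor equivalent means equivalent as ($k$-linear) monoidal categories. *)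

(* Defs.v *)
From HB Require Import structures.
From mathcomp Require Import all_boot all_order all_algebra all_fingroup all_solvable ring.
Set Implicit Arguments.
Unset Strict Implicit.
Unset Printing Implicit Defensive.
Import GRing.Theory.
Local Open Scope ring_scope.

Record linCat (k : fieldType) := LinCat {
  obj :> Type;
  mor : obj -> obj -> lmodType k;
  idmor : forall X, mor X X;
  ccomp : forall X Y Z, mor Y Z -> mor X Y -> mor X Z;
  comp1m : forall X Y (f : mor X Y), ccomp (idmor Y) f = f;
  compm1 : forall X Y (f : mor X Y), ccomp f (idmor X) = f;
  compA : forall W X Y Z (f : mor Y Z) (g : mor X Y) (h : mor W X),
    ccomp f (ccomp g h) = ccomp (ccomp f g) h;
  comp_linr : forall X Y Z (f : mor Y Z), linear (fun g : mor X Y => ccomp f g);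
  comp_linl : forall X Y Z (g : mor X Y), linear (fun f : mor Y Z => ccomp f g) }.

Arguments mor {k l} X Y.
Arguments idmor {k l} X.
Arguments ccomp {k l X Y Z} f g.

Declare Scope cat_scope.
Local Open Scope cat_scope.
Notation "f ∘ g" := (ccomp f g) (at level 40, left associativity) : cat_scope.

Definition is_isom (k : fieldType) (C : linCat k) (X Y : C) (f : mor X Y) :=
  exists g : mor Y X, g ∘ f = idmor X /\ f ∘ g = idmor Y.

Record linFunctor (k : fieldType) (C D : linCat k) := LinFunctor {
  fobj :> C -> D;
  fmap : forall X Y, mor X Y -> mor (fobj X) (fobj Y);
  fmap1 : forall X, fmap (idmor X) = idmor (fobj X);
  fmapM : forall X Y Z (f : mor Y Z) (g : mor X Y),
    fmap (f ∘ g) = fmap f ∘ fmap g;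
  fmap_lin : forall X Y, linear (@fmap X Y) }.

Arguments fmap {k C D} l {X Y} f.

Section Functors.
Variable k : fieldType.

Definition idFunctor (C : linCat k) : linFunctor C C.
Proof. by exists (fun X => X) (fun X Y f => f). Defined.

Definition compFunctor (C D E : linCat k) (G : linFunctor D E)
  (F : linFunctor C D) : linFunctor C E.
Proof.
exists (fun X => G (F X)) (fun X Y f => fmap G (fmap F f)).
- by move=> X; rewrite !fmap1.
- by move=> X Y Z f g; rewrite !fmapM.
- by move=> X Y a f g; rewrite !fmap_lin.
Defined.

Definition naturally_isomorphic (C D : linCat k) (F G : linFunctor C D) :=
  exists t : forall X, mor (F X) (G X),
    (forall X Y (f : mor X Y), t Y ∘ fmap F f = fmap G f ∘ t X) /\
    (forall X, is_isom (t X)).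

Definition is_equivalence (C D : linCat k) (F : linFunctor C D) :=
  exists G : linFunctor D C,
    naturally_isomorphic (compFunctor G F) (idFunctor C) /\
    naturally_isomorphic (compFunctor F G) (idFunctor D).

End Functors.

Record monCat (k : fieldType) := MonCat {
  mcat :> linCat k;
  tens : mcat -> mcat -> mcat;
  tensm : forall X X' Y Y' : mcat,
    mor X X' -> mor Y Y' -> mor (tens X Y) (tens X' Y');
  tensm1 : forall X Y, tensm (idmor X) (idmor Y) = idmor (tens X Y);
  tensmM : forall (X X' X'' Y Y' Y'' : mcat) (f' : mor X' X'') (f : mor X X')
      (g' : mor Y' Y'') (g : mor Y Y'),
    tensm (f' ∘ f) (g' ∘ g) = tensm f' g' ∘ tensm f g;
  tensm_linr : forall (X X' Y Y' : mcat) (f : mor X X'),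
    linear (fun g : mor Y Y' => tensm f g);
  tensm_linl : forall (X X' Y Y' : mcat) (g : mor Y Y'),
    linear (fun f : mor X X' => tensm f g);
  unitO : mcat;
  assoc : forall X Y Z, mor (tens (tens X Y) Z) (tens X (tens Y Z));
  assoc_nat : forall (X X' Y Y' Z Z' : mcat)
      (f : mor X X') (g : mor Y Y') (h : mor Z Z'),
    assoc X' Y' Z' ∘ tensm (tensm f g) h = tensm f (tensm g h) ∘ assoc X Y Z;
  assoc_iso : forall X Y Z, is_isom (assoc X Y Z);
  lunit : forall X, mor (tens unitO X) X;
  lunit_nat : forall (X X' : mcat) (f : mor X X'),
    lunit X' ∘ tensm (idmor unitO) f = f ∘ lunit X;
  lunit_iso : forall X, is_isom (lunit X);
  runit : forall X, mor (tens X unitO) X;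
  runit_nat : forall (X X' : mcat) (f : mor X X'),
    runit X' ∘ tensm f (idmor unitO) = f ∘ runit X;
  runit_iso : forall X, is_isom (runit X);
  pentagon : forall W X Y Z,
    assoc W X (tens Y Z) ∘ assoc (tens W X) Y Z =
    tensm (idmor W) (assoc X Y Z) ∘ assoc W (tens X Y) Z
      ∘ tensm (assoc W X Y) (idmor Z);
  triangle : forall X Y,
    tensm (idmor X) (lunit Y) ∘ assoc X unitO Y = tensm (runit X) (idmor Y) }.

Arguments tens {k m} X Y.
Arguments tensm {k m X X' Y Y'} f g.
Arguments unitO {k} m.
Arguments assoc {k m} X Y Z.
Arguments lunit {k m} X.
Arguments runit {k m} X.

Record monFunctor (k : fieldType) (C D : monCat k) := MonFunctor {
  mfun :> linFunctor C D;
  mf_tens : forall X Y : C, mor (tens (mfun X) (mfun Y)) (mfun (tens X Y));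
  mf_tens_nat : forall (X X' Y Y' : C) (f : mor X X') (g : mor Y Y'),
    mf_tens X' Y' ∘ tensm (fmap mfun f) (fmap mfun g) =
    fmap mfun (tensm f g) ∘ mf_tens X Y;
  mf_tens_iso : forall X Y, is_isom (mf_tens X Y);
  mf_unit : mor (unitO D) (mfun (unitO C));
  mf_unit_iso : is_isom mf_unit;
  mf_assoc : forall X Y Z : C,
    fmap mfun (assoc X Y Z) ∘ mf_tens (tens X Y) Z
      ∘ tensm (mf_tens X Y) (idmor (mfun Z)) =
    mf_tens X (tens Y Z) ∘ tensm (idmor (mfun X)) (mf_tens Y Z)
      ∘ assoc (mfun X) (mfun Y) (mfun Z);
  mf_lunit : forall X : C,
    fmap mfun (lunit X) ∘ mf_tens (unitO C) X ∘ tensm mf_unit (idmor (mfun X)) =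
    lunit (mfun X);
  mf_runit : forall X : C,
    fmap mfun (runit X) ∘ mf_tens X (unitO C) ∘ tensm (idmor (mfun X)) mf_unit =
    runit (mfun X) }.

(* The quasi-inverse is a plain functor: it inherits a monoidal structure. *)
Definition tensor_equivalent (k : fieldType) (C D : monCat k) :=
  exists F : monFunctor C D, is_equivalence F.

Section VTensor.
Variable k : fieldType.
Implicit Types U V T : vectType k.

(* U ⊗ V is modelled by coordinate matrices, u ⊗ v being the rank one matrix
   with entries u_i v_j. [vlift_tmul] and [vtens_ext] are the universal
   property. *)
Definition vtens U V : vectType k := 'M[k]_(\dim {:U}, \dim {:V}).

Definition vcoord U (u : U) i : k := coord (vbasis {:U}) i u.

Definition tmul U V (u : U) (v : V) : vtens U V :=
  \matrix_(i, j) (vcoord u i * vcoord v j).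

Lemma tmul_linr U V (u : U) : linear (fun v : V => tmul u v).
Proof.
move=> a v w; apply/matrixP => i j.
by rewrite !mxE /vcoord linearP mulrDr mulrCA.
Qed.

Lemma tmul_linl U V (v : V) : linear (fun u : U => tmul u v).
Proof.
move=> a u w; apply/matrixP => i j.
by rewrite !mxE /vcoord linearP mulrDl mulrA.
Qed.

Definition tmulr U V (v : V) (u : U) := tmul u v.

HB.instance Definition _ U V (u : U) :=
  GRing.isLinear.Build k V (vtens U V) *:%R (@tmul U V u) (tmul_linr u).
HB.instance Definition _ U V (v : V) :=
  GRing.isLinear.Build k U (vtens U V) *:%R (@tmulr U V v) (tmul_linl v).

Lemma tmul0r U V (u : U) : tmul u (0 : V) = 0. Proof. exact: linear0. Qed.
Lemma tmulDr U V (u : U) (v w : V) : tmul u (v + w) = tmul u v + tmul u w.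
Proof. exact: linearD. Qed.
Lemma tmulZr U V (u : U) a (v : V) : tmul u (a *: v) = a *: tmul u v.
Proof. exact: linearZ. Qed.
Lemma tmul0l U V (v : V) : tmul (0 : U) v = 0.
Proof. exact: (linear0 (tmulr v)). Qed.
Lemma tmulDl U V (v : V) (u w : U) : tmul (u + w) v = tmul u v + tmul w v.
Proof. exact: (linearD (tmulr v)). Qed.
Lemma tmulZl U V (v : V) a (u : U) : tmul (a *: u) v = a *: tmul u v.
Proof. exact: (linearZ_LR (tmulr v)). Qed.

Definition bilin U V (T : lmodType k) (f : U -> V -> T) :=
  (forall u, linear (f u)) /\ (forall v, linear (f^~ v)).

Definition vbas U (i : 'I_(\dim {:U})) : U := (vbasis {:U})`_i.

Definition vlift_fun U V (T : vectType k) (f : U -> V -> T) (M : vtens U V) : T :=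
  \sum_i \sum_j (M : 'M_(_, _)) i j *: f (vbas i) (vbas j).

Fact vlift_is_linear U V T (f : U -> V -> T) : linear (vlift_fun f).
Proof.
move=> a M N; rewrite /vlift_fun scaler_sumr -big_split; apply: eq_bigr => i _.
rewrite scaler_sumr -big_split; apply: eq_bigr => j _ /=.
by rewrite !mxE scalerDl scalerA.
Qed.

HB.instance Definition _ U V (T : vectType k) (f : U -> V -> T) :=
  GRing.isLinear.Build k (vtens U V) T *:%R (vlift_fun f) (vlift_is_linear f).

Definition vlift U V (T : vectType k) (f : U -> V -> T) : 'Hom(vtens U V, T) :=
  linfun (vlift_fun f).

Lemma lin_sum (A B : lmodType k) (f : A -> B) : linear f ->
  forall I (r : seq I) (c : I -> k) (F : I -> A),
  f (\sum_(i <- r) c i *: F i) = \sum_(i <- r) c i *: f (F i).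
Proof.
move=> lf I r c F.
have f0 : f 0 = 0 by rewrite -[X in f X](subrr 0) -scaleN1r addrC lf scaleN1r addNr.
elim: r => [|i r IH]; first by rewrite !big_nil.
by rewrite !big_cons lf IH.
Qed.

Lemma vbas_sum U (u : U) : u = \sum_i vcoord u i *: vbas i.
Proof. exact: coord_vbasis (memvf u). Qed.

Lemma vcoord_vbas U (i j : 'I_(\dim {:U})) : vcoord (vbas i) j = (i == j)%:R.
Proof. by rewrite /vcoord coord_free ?(basis_free (vbasisP _)) // eq_sym. Qed.


Lemma vlift_tmul U V T (f : U -> V -> T) u v :
  bilin f -> vlift f (tmul u v) = f u v.
Proof.
move=> [fr fl]; rewrite lfunE /= /vlift_fun.
rewrite {2}[u]vbas_sum (lin_sum (fl v)); apply: eq_bigr => i _.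
rewrite {2}[v]vbas_sum (lin_sum (fr _)) scaler_sumr; apply: eq_bigr => j _.
by rewrite scalerA mxE.
Qed.

Lemma vtens_sum U V (M : vtens U V) :
  M = \sum_i \sum_j (M : 'M_(_, _)) i j *: tmul (vbas i) (vbas j).
Proof.
rewrite {1}[M]matrix_sum_delta; apply: eq_bigr => i _; apply: eq_bigr => j _.
congr (_ *: _); apply/matrixP => i' j'.
by rewrite !mxE !vcoord_vbas -natrM mulnb [i == i']eq_sym [j == j']eq_sym.
Qed.

Lemma vtens_ind U V (P : vtens U V -> Prop) :
  (forall s t, P s -> P t -> P (s + t)) -> (forall u v, P (tmul u v)) ->
  forall t, P t.
Proof.
move=> PD Pm t.
have P0 : P 0 by rewrite -(tmul0r V (0 : U)).
rewrite [t]vtens_sum; apply: big_ind => // i _; apply: big_ind => // j _.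
by rewrite -tmulZl; apply: Pm.
Qed.

Lemma vtens_ext U V (T : vectType k) (f g : 'Hom(vtens U V, T)) :
  (forall u v, f (tmul u v) = g (tmul u v)) -> f = g.
Proof.
move=> fg; apply/lfunP; apply: vtens_ind => // s t fs ft.
by rewrite !linearD /= fs ft.
Qed.

Definition vtensm U U' V V' (f : 'Hom(U, U')) (g : 'Hom(V, V')) :
    'Hom(vtens U V, vtens U' V') :=
  vlift (fun u v => tmul (f u) (g v)).

Lemma vtensm_tmul U U' V V' (f : 'Hom(U, U')) (g : 'Hom(V, V')) u v :
  vtensm f g (tmul u v) = tmul (f u) (g v).
Proof.
rewrite vlift_tmul //; split=> w a x y; rewrite linearP.
- exact: tmul_linr.
- exact: (tmul_linl (g w)).
Qed.

Definition vtensv U V (A : {vspace U}) (B : {vspace V}) : {vspace vtens U V} :=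
  <<[seq tmul u v | u <- vbasis A, v <- vbasis B]>>%VS.

Lemma memv_tmul U V (A : {vspace U}) (B : {vspace V}) u v :
  u \in A -> v \in B -> tmul u v \in vtensv A B.
Proof.
move=> uA vB; rewrite (coord_vbasis uA) (lin_sum (@tmul_linl U V v)).
apply: rpred_sum => i _; apply: rpredZ.
rewrite (coord_vbasis vB) (lin_sum (@tmul_linr U V _)).
apply: rpred_sum => j _; apply: rpredZ; apply: memv_span.
by apply: allpairs_f; rewrite mem_nth ?size_tuple.
Qed.

Lemma vtensv_sub U V (A : {vspace U}) (B : {vspace V}) (W : {vspace vtens U V}) :
  (forall u v, u \in A -> v \in B -> tmul u v \in W) -> (vtensv A B <= W)%VS.
Proof.
move=> AB; apply/span_subvP => _ /allpairsP[[u v] /= [uA vB ->]].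
by apply: AB; apply: vbasis_mem.
Qed.

End VTensor.

Section Graded.
Variables (k : fieldType) (gT : finGroupType).

(* [directv] inspects the syntax of its argument: the abstraction over [A]
   makes it mean directness of the outer sum even when [A g] is itself a sum. *)
Definition is_direct (V : vectType k) (A : gT -> {vspace V}) :=
  directv (\sum_g A g).

(* Internal gradings: the degree g component is the subspace [gr g]. *)
Record grSpace := GrSpace {
  gsp :> vectType k;
  gr : gT -> {vspace gsp};
  gr_direct : is_direct gr;
  gr_full : (\sum_g gr g)%VS = fullv }.

Implicit Types T U V W X : grSpace.

Definition grproj V (g : gT) : 'End(V) := sumv_pi_for (esym (gr_full V)) g.

Lemma grproj_mem V g v : grproj V g v \in gr V g.
Proof. exact: memv_sum_pi. Qed.

Lemma grproj_sum V v : \sum_g grproj V g v = v.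
Proof. by apply: sumv_pi_sum; rewrite memvf. Qed.

Lemma grproj_id V g h v :
  v \in gr V h -> grproj V g v = if g == h then v else 0.
Proof.
move=> vh; have /directv_sum_unique dir := gr_direct V.
pose vs i := if i == h then v else 0.
have vsP i : vs i \in gr V i by rewrite /vs; case: eqP => [->|_]; rewrite ?mem0v.
have := dir (fun i => grproj V i v) vs (fun i _ => grproj_mem i v)
  (fun i _ => vsP i).
rewrite grproj_sum [X in v == X](bigD1 h) //= {1}/vs eqxx big1 ?addr0 ?eqxx.
  by move=> /esym/forallP/(_ g)/eqP.
by move=> i /negbTE; rewrite /vs => ->.
Qed.

Lemma gr_ind V (P : V -> Prop) :
  (forall v w, P v -> P w -> P (v + w)) ->
  (forall g v, v \in gr V g -> P v) -> forall v, P v.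
Proof.
move=> PD Ph v; rewrite -[v]grproj_sum; apply: big_ind => //.
- by apply: (Ph 1%g); rewrite mem0v.
- by move=> g _; apply: (Ph g); apply: grproj_mem.
Qed.

Definition is_graded V W : {pred 'Hom(V, W)} :=
  fun f => [forall g, (f @: gr V g <= gr W g)%VS].

Arguments is_graded V W _ : clear implicits.

Lemma is_gradedP V W (f : 'Hom(V, W)) :
  reflect (forall g v, v \in gr V g -> f v \in gr W g) (f \in is_graded V W).
Proof.
apply: (iffP forallP) => [fg g v vg|fg g].
  by apply: subvP (fg g) _ _; apply: memv_img.
by apply/subvP => _ /memv_imgP[v vg ->]; apply: fg.
Qed.

Fact is_graded_submod V W : submod_closed (is_graded V W).
Proof.
split=> [|a f h /is_gradedP fg /is_gradedP hg]; apply/is_gradedP => g v vg.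
  by rewrite zero_lfunE mem0v.
by rewrite !lfunE /= lfunE /= rpredD ?rpredZ ?fg ?hg.
Qed.

HB.instance Definition _ V W :=
  GRing.isSubmodClosed.Build k 'Hom(V, W) (is_graded V W) (is_graded_submod V W).

Record grHom V W := GrHom {
  grhom :> 'Hom(V, W);
  grhomP : grhom \in is_graded V W }.

HB.instance Definition _ V W := [isSub for @grhom V W].
HB.instance Definition _ V W := [Choice of grHom V W by <:].
HB.instance Definition _ V W := [SubChoice_isSubLmodule of grHom V W by <:].

Lemma grhom_mem V W (f : grHom V W) g v : v \in gr V g -> f v \in gr W g.
Proof. exact: (is_gradedP _ (grhomP f)). Qed.

Lemma grhom_inj V W (f g : grHom V W) : grhom f = grhom g -> f = g.
Proof. exact: val_inj. Qed.

Fact grid_graded V : \1%VF \in is_graded V V.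
Proof. by apply/is_gradedP => g v; rewrite id_lfunE. Qed.
Definition grid V : grHom V V := GrHom (grid_graded V).

Fact grcomp_graded U V W (f : grHom V W) (g : grHom U V) :
  (f \o g)%VF \in is_graded U W.
Proof. by apply/is_gradedP => x v vx; rewrite comp_lfunE !grhom_mem. Qed.
Definition grcomp U V W (f : grHom V W) (g : grHom U V) : grHom U W :=
  GrHom (grcomp_graded f g).

Definition VecLin : linCat k.
Proof.
apply: (@LinCat k grSpace (fun V W => grHom V W : lmodType k) grid grcomp).
- by move=> V W f; apply: grhom_inj; rewrite /= comp_lfun1l.
- by move=> V W f; apply: grhom_inj; rewrite /= comp_lfun1r.
- by move=> U1 U2 U3 U4 f g h; apply: grhom_inj; rewrite /= comp_lfunA.
- move=> U V W f a g h; apply: grhom_inj => /=.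
  by rewrite comp_lfunDr -comp_lfunZr.
- move=> U V W f a g h; apply: grhom_inj => /=.
  by rewrite comp_lfunDl -comp_lfunZl.
Defined.

Definition tgr V W (g : gT) : {vspace vtens V W} :=
  (\sum_(p : gT * gT | (p.1 * p.2)%g == g) vtensv (gr V p.1) (gr W p.2))%VS.

Lemma tgr_tmul V W x y g v w : (x * y)%g = g ->
  v \in gr V x -> w \in gr W y -> tmul v w \in tgr V W g.
Proof.
move=> xy vx wy; have := memv_tmul vx wy; apply: subvP.
by apply: (sumv_sup (x, y)); rewrite //= xy.
Qed.

Lemma tgr_ind V W g (P : vtens V W -> Prop) :
  (forall s t, P s -> P t -> P (s + t)) ->
  (forall x y v w, (x * y)%g = g -> v \in gr V x -> w \in gr W y ->
    P (tmul v w)) ->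
  forall t, t \in tgr V W g -> P t.
Proof.
move=> PD Pm t /memv_sumP[us uP ->].
have P0 : P 0.
  by rewrite -(tmul0r W (0 : V)); apply: (Pm g 1%g); rewrite ?mulg1 ?mem0v.
apply: big_ind => // p pg.
set X := [seq tmul u v | u <- vbasis (gr V p.1), v <- vbasis (gr W p.2)].
have /coord_span -> : us p \in <<in_tuple X>>%VS := uP p pg.
apply: big_ind => // i _.
have /allpairsP[[v w] /= [/vbasis_mem vx /vbasis_mem wy ->]] : X`_i \in X.
  by rewrite mem_nth.
by rewrite -tmulZl; apply: (Pm p.1 p.2); rewrite ?rpredZ //; apply/eqP.
Qed.

Lemma htens_ind V W (P : vtens V W -> Prop) :
  (forall s t, P s -> P t -> P (s + t)) ->
  (forall x y v w, v \in gr V x -> w \in gr W y -> P (tmul v w)) ->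
  forall t, P t.
Proof.
move=> PD Pm; apply: vtens_ind => // v w.
elim/gr_ind: v => [v1 v2|x v vx]; first by rewrite tmulDl; apply: PD.
elim/gr_ind: w => [w1 w2|y w wy]; first by rewrite tmulDr; apply: PD.
exact: Pm vx wy.
Qed.

Fact tgr_full V W : (\sum_g tgr V W g)%VS = fullv.
Proof.
apply/eqP; rewrite eqEsubv subvf /=; apply/subvP => t _.
elim/htens_ind: t => [s t|x y v w vx wy]; first exact: rpredD.
have := tgr_tmul erefl vx wy; apply: subvP.
exact: (sumv_sup (x * y)%g).
Qed.

Definition tproj V W g : 'End(vtens V W) :=
  \sum_(p : gT * gT | (p.1 * p.2)%g == g) vtensm (grproj V p.1) (grproj W p.2).

Lemma tproj_id V W g h t :
  t \in tgr V W h -> tproj V W g t = if g == h then t else 0.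
Proof.
elim/tgr_ind => [s t' es et|x y v w xy vx wy].
  by rewrite linearD /= es et; case: eqP => // _; rewrite addr0.
rewrite /tproj sum_lfunE; case: (eqVneq g h) => [->|ngh].
  rewrite (bigD1 (x, y)) /= ?xy // vtensm_tmul.
  rewrite (grproj_id _ vx) (grproj_id _ wy) !eqxx big1 ?addr0 // => -[x' y'].
  rewrite /= => /andP[_ ne]; rewrite vtensm_tmul.
  rewrite (grproj_id _ vx) (grproj_id _ wy); move: ne; rewrite -pair_eqE /=.
  by case: eqP => // _; case: eqP => // _; rewrite ?tmul0r ?tmul0l.
apply: big1 => -[x' y'] /= xy'; rewrite vtensm_tmul.
rewrite (grproj_id _ vx) (grproj_id _ wy).
case: eqP => [ex|_]; case: eqP => [ey|_]; rewrite ?tmul0r ?tmul0l //.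
by move: ngh; rewrite -(eqP xy') ex ey xy eqxx.
Qed.

Fact tgr_direct V W : is_direct (@tgr V W).
Proof.
apply/directv_sum_independent => us usP us0 g _.
have := linear0 (tproj V W g); rewrite -us0 linear_sum (bigD1 g) //=.
rewrite (tproj_id _ (usP g isT)) eqxx big1 ?addr0 // => h hg.
by rewrite (tproj_id _ (usP h isT)) eq_sym (negbTE hg).
Qed.

Definition grtens V W : grSpace := GrSpace (tgr_direct V W) (tgr_full V W).

Lemma grtens_graded V W T (f : 'Hom(grtens V W, T)) :
  (forall x y v w, v \in gr V x -> w \in gr W y ->
    f (tmul v w) \in gr T (x * y)%g) -> f \in is_graded (grtens V W) T.
Proof.
move=> fP; apply/is_gradedP => g t; rewrite /=.
elim/tgr_ind => [s t'|x y v w <- vx wy]; first by rewrite linearD; apply: rpredD.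
exact: fP.
Qed.

Fact grtensm_graded V V' W W' (f : grHom V V') (g : grHom W W') :
  vtensm f g \in is_graded (grtens V W) (grtens V' W').
Proof.
apply: grtens_graded => x y v w vx wy; rewrite vtensm_tmul.
by apply: (@tgr_tmul V' W' x y); rewrite // grhom_mem.
Qed.
Definition grtensm V V' W W' (f : grHom V V') (g : grHom W W') :
  grHom (grtens V W) (grtens V' W') := GrHom (grtensm_graded f g).

Definition ugr (g : gT) : {vspace k^o} := if g == 1%g then fullv else 0%VS.

Fact ugr_full : (\sum_g ugr g)%VS = fullv.
Proof.
apply/eqP; rewrite eqEsubv subvf /=; apply: (sumv_sup 1%g) => //.
by rewrite /ugr eqxx.
Qed.

Fact ugr_direct : is_direct ugr.
Proof.
apply/directv_sum_independent => us usP us0.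
have us1 g : g != 1%g -> us g = 0.
  by move=> /negbTE g1; have := usP g isT; rewrite /ugr g1 memv0 => /eqP.
move=> g _; have [->|/us1//] := eqVneq g 1%g.
by rewrite -us0 (bigD1 1%g) //= big1 ?addr0 // => h /us1.
Qed.

(* k concentrated in degree 1. *)
Definition grunit : grSpace := GrSpace ugr_direct ugr_full.

Lemma grunitP g c : c \in gr grunit g -> g = 1%g \/ c = 0.
Proof.
rewrite /= /ugr; case: eqP => [|_]; first by left.
by rewrite memv0 => /eqP; right.
Qed.

Definition lunit_lin (V : vectType k) : 'Hom(vtens k^o V, V) :=
  vlift (fun (c : k^o) v => (c : k) *: v).
Definition runit_lin (V : vectType k) : 'Hom(vtens V k^o, V) :=
  vlift (fun v (c : k^o) => (c : k) *: v).
Definition lunit_inv_lin (V : vectType k) : 'Hom(V, vtens k^o V) :=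
  linfun (tmul (1 : k^o)).
Definition runit_inv_lin (V : vectType k) : 'Hom(V, vtens V k^o) :=
  linfun (tmulr (1 : k^o)).

Lemma lunit_lin_tmul (V : vectType k) (c : k^o) (v : V) :
  lunit_lin V (tmul c v) = (c : k) *: v.
Proof.
rewrite vlift_tmul //; split=> [d a v1 v2|w a d1 d2].
  by rewrite scalerDr !scalerA mulrC.
by rewrite scalerDl scalerA.
Qed.

Lemma runit_lin_tmul (V : vectType k) (c : k^o) (v : V) :
  runit_lin V (tmul v c) = (c : k) *: v.
Proof.
rewrite vlift_tmul //; split=> [w a d1 d2|d a v1 v2].
  by rewrite scalerDl scalerA.
by rewrite scalerDr !scalerA mulrC.
Qed.

Fact lunit_graded V : lunit_lin V \in is_graded (grtens grunit V) V.
Proof.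
apply: grtens_graded => x y c v cx vy; rewrite lunit_lin_tmul.
have [->|->] := grunitP cx; last by rewrite scale0r mem0v.
by rewrite mul1g rpredZ.
Qed.
Definition grlunit V : grHom (grtens grunit V) V := GrHom (lunit_graded V).

Fact runit_graded V : runit_lin V \in is_graded (grtens V grunit) V.
Proof.
apply: grtens_graded => x y v c vx cy; rewrite runit_lin_tmul.
have [->|->] := grunitP cy; last by rewrite scale0r mem0v.
by rewrite mulg1 rpredZ.
Qed.
Definition grrunit V : grHom (grtens V grunit) V := GrHom (runit_graded V).

Fact lunit_inv_graded V : lunit_inv_lin V \in is_graded V (grtens grunit V).
Proof.
apply/is_gradedP => g v vg; rewrite lfunE /=.
apply: (@tgr_tmul grunit V 1%g g) => //; first exact: mul1g.
by rewrite /= /ugr eqxx memvf.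
Qed.
Definition grlunit_inv V : grHom V (grtens grunit V) :=
  GrHom (lunit_inv_graded V).

Fact runit_inv_graded V : runit_inv_lin V \in is_graded V (grtens V grunit).
Proof.
apply/is_gradedP => g v vg; rewrite lfunE /=.
apply: (@tgr_tmul V grunit g 1%g) => //; first exact: mulg1.
by rewrite /= /ugr eqxx memvf.
Qed.
Definition grrunit_inv V : grHom V (grtens V grunit) :=
  GrHom (runit_inv_graded V).

Definition assoc_lin (U V W : vectType k) :
    'Hom(vtens (vtens U V) W, vtens U (vtens V W)) :=
  vlift (fun t w => vlift (fun u v => tmul u (tmul v w)) t).

Definition assoc_inv_lin (U V W : vectType k) :
    'Hom(vtens U (vtens V W), vtens (vtens U V) W) :=
  vlift (fun u t => vlift (fun v w => tmul (tmul u v) w) t).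

Lemma assoc_lin_tmul (U V W : vectType k) (u : U) (v : V) (w : W) :
  assoc_lin U V W (tmul (tmul u v) w) = tmul u (tmul v w).
Proof.
have bil (w' : W) : bilin (fun (u : U) (v : V) => tmul u (tmul v w')).
  split=> [u' a v1 v2|v' a u1 u2]; last by rewrite tmul_linl.
  by rewrite tmul_linl tmul_linr.
rewrite vlift_tmul ?vlift_tmul //; split=> [t|w' a t1 t2]; last first.
  by rewrite linearP.
move: t; apply: vtens_ind => [s t ls lt a w1 w2|u' v' a w1 w2].
  by rewrite !linearD /= ls lt addrACA.
by rewrite !vlift_tmul // !tmul_linr.
Qed.

Lemma assoc_inv_lin_tmul (U V W : vectType k) (u : U) (v : V) (w : W) :
  assoc_inv_lin U V W (tmul u (tmul v w)) = tmul (tmul u v) w.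
Proof.
have bil (u' : U) : bilin (fun (v : V) (w : W) => tmul (tmul u' v) w).
  split=> [v' a w1 w2|w' a v1 v2]; first by rewrite tmul_linr.
  by rewrite tmul_linr tmul_linl.
rewrite vlift_tmul ?vlift_tmul //; split=> [u' a t1 t2|t].
  by rewrite linearP.
move: t; apply: vtens_ind => [s t ls lt a w1 w2|u' v' a w1 w2].
  by rewrite !linearD /= ls lt addrACA.
by rewrite !vlift_tmul // !tmul_linl.
Qed.

Section Assoc.
Variable Phi : gT -> gT -> gT -> k.

(* On homogeneous vectors this is (u ⊗ v) ⊗ w |-> Phi x y z u ⊗ (v ⊗ w), see
   [twassoc_tmul]. *)
Definition twassoc_lin U V W :
    'Hom(vtens (vtens U V) W, vtens U (vtens V W)) :=
  \sum_x \sum_y \sum_z Phi x y z *: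
    (assoc_lin U V W
       \o vtensm (vtensm (grproj U x) (grproj V y)) (grproj W z))%VF.

Definition twassoc_inv_lin U V W :
    'Hom(vtens U (vtens V W), vtens (vtens U V) W) :=
  \sum_x \sum_y \sum_z Phi x y z *:
    (assoc_inv_lin U V W
       \o vtensm (grproj U x) (vtensm (grproj V y) (grproj W z)))%VF.

Lemma sum3_only (A : lmodType k) (F : gT -> gT -> gT -> A) x y z :
  (forall x' y' z', [|| x' != x, y' != y | z' != z] -> F x' y' z' = 0) ->
  \sum_x \sum_y \sum_z F x y z = F x y z.
Proof.
move=> F0; rewrite (bigD1 x) //= [X in _ + X]big1 ?addr0; last first.
  by move=> x' ne; do 2!apply: big1 => ? _; rewrite F0 ?ne.
rewrite (bigD1 y) //= [X in _ + X]big1 ?addr0; last first.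
  by move=> y' ne; apply: big1 => ? _; rewrite F0 ?ne ?orbT.
rewrite (bigD1 z) //= [X in _ + X]big1 ?addr0 //.
by move=> z' ne; rewrite F0 ?ne ?orbT.
Qed.

Lemma twassoc_tmul U V W x y z u v w :
  u \in gr U x -> v \in gr V y -> w \in gr W z ->
  twassoc_lin U V W (tmul (tmul u v) w) = Phi x y z *: tmul u (tmul v w).
Proof.
move=> ux vy wz.
transitivity (\sum_x \sum_y \sum_z Phi x y z *:
  tmul (grproj U x u) (tmul (grproj V y v) (grproj W z w))).
  rewrite sum_lfunE; apply: eq_bigr => x' _.
  rewrite sum_lfunE; apply: eq_bigr => y' _.
  rewrite sum_lfunE; apply: eq_bigr => z' _.
  by rewrite scale_lfunE comp_lfunE !vtensm_tmul assoc_lin_tmul.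
rewrite (@sum3_only _ _ x y z) => [|x' y' z'].
  by rewrite (grproj_id _ ux) (grproj_id _ vy) (grproj_id _ wz) !eqxx.
rewrite (grproj_id _ ux) (grproj_id _ vy) (grproj_id _ wz).
by case: eqP => /= _; case: eqP => /= _; case: eqP => //= _ _;
  rewrite ?tmul0r ?tmul0l ?tmul0r ?scaler0.
Qed.

Lemma twassoc_inv_tmul U V W x y z u v w :
  u \in gr U x -> v \in gr V y -> w \in gr W z ->
  twassoc_inv_lin U V W (tmul u (tmul v w)) = Phi x y z *: tmul (tmul u v) w.
Proof.
move=> ux vy wz.
transitivity (\sum_x \sum_y \sum_z Phi x y z *:
  tmul (tmul (grproj U x u) (grproj V y v)) (grproj W z w)).
  rewrite sum_lfunE; apply: eq_bigr => x' _.
  rewrite sum_lfunE; apply: eq_bigr => y' _.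
  rewrite sum_lfunE; apply: eq_bigr => z' _.
  by rewrite scale_lfunE comp_lfunE !vtensm_tmul assoc_inv_lin_tmul.
rewrite (@sum3_only _ _ x y z) => [|x' y' z'].
  by rewrite (grproj_id _ ux) (grproj_id _ vy) (grproj_id _ wz) !eqxx.
rewrite (grproj_id _ ux) (grproj_id _ vy) (grproj_id _ wz).
by case: eqP => /= _; case: eqP => /= _; case: eqP => //= _ _;
  rewrite ?tmul0r ?tmul0l ?tmul0r ?tmul0l ?scaler0.
Qed.

Fact twassoc_graded U V W : twassoc_lin U V W
  \in is_graded (grtens (grtens U V) W) (grtens U (grtens V W)).
Proof.
apply: grtens_graded => g z t w /= tg wz; move: t tg.
apply: tgr_ind => [s t|x y u v <- ux vy].
  by rewrite tmulDl linearD; apply: rpredD.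
rewrite (twassoc_tmul ux vy wz) rpredZ // -mulgA.
apply: (@tgr_tmul U (grtens V W) x (y * z)%g) => //.
exact: (@tgr_tmul V W y z).
Qed.
Definition twassoc U V W :
    grHom (grtens (grtens U V) W) (grtens U (grtens V W)) :=
  GrHom (twassoc_graded U V W).

Fact twassoc_inv_graded U V W : twassoc_inv_lin U V W
  \in is_graded (grtens U (grtens V W)) (grtens (grtens U V) W).
Proof.
apply: grtens_graded => x g u t /= ux tg; move: t tg.
apply: tgr_ind => [s t|y z v w <- vy wz].
  by rewrite tmulDr linearD; apply: rpredD.
rewrite (twassoc_inv_tmul ux vy wz) rpredZ // mulgA.
apply: (@tgr_tmul (grtens U V) W (x * y)%g z) => //.
exact: (@tgr_tmul U V x y).
Qed.
Definition twassoc_inv U V W :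
    grHom (grtens U (grtens V W)) (grtens (grtens U V) W) :=
  GrHom (twassoc_inv_graded U V W).

End Assoc.

Lemma grtens_ext V W T (f g : grHom (grtens V W) T) :
  (forall x y v w, v \in gr V x -> w \in gr W y ->
    f (tmul v w) = g (tmul v w)) -> f = g.
Proof.
move=> fg; apply: grhom_inj; apply/lfunP; apply: htens_ind => [s t fs ft|].
  by rewrite !linearD /= fs ft.
exact: fg.
Qed.

Lemma grtens3_ext U V W T (f g : grHom (grtens (grtens U V) W) T) :
  (forall x y z u v w, u \in gr U x -> v \in gr V y -> w \in gr W z ->
    f (tmul (tmul u v) w) = g (tmul (tmul u v) w)) -> f = g.
Proof.
move=> fg; apply: grtens_ext => s z t w _ wz.
move: t; apply: htens_ind => [t1 t2 f1 f2|x y u v ux vy].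
  by rewrite tmulDl !linearD /= f1 f2.
exact: fg ux vy wz.
Qed.

Lemma grtens3r_ext U V W T (f g : grHom (grtens U (grtens V W)) T) :
  (forall x y z u v w, u \in gr U x -> v \in gr V y -> w \in gr W z ->
    f (tmul u (tmul v w)) = g (tmul u (tmul v w))) -> f = g.
Proof.
move=> fg; apply: grtens_ext => x s u t ux _.
move: t; apply: htens_ind => [t1 t2 f1 f2|y z v w vy wz].
  by rewrite tmulDr !linearD /= f1 f2.
exact: fg ux vy wz.
Qed.

Lemma grtens4_ext U V W X T
    (f g : grHom (grtens (grtens (grtens U V) W) X) T) :
  (forall a b c d u v w x,
    u \in gr U a -> v \in gr V b -> w \in gr W c -> x \in gr X d ->
    f (tmul (tmul (tmul u v) w) x) = g (tmul (tmul (tmul u v) w) x)) -> f = g.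
Proof.
move=> fg; apply: grtens3_ext => s c d t w x _ wc xd.
move: t; apply: htens_ind => [t1 t2 f1 f2|a b u v ua vb].
  by rewrite !tmulDl !linearD /= f1 f2.
exact: fg ua vb wc xd.
Qed.

Record cocycle3 := Cocycle3 {
  coc :> gT -> gT -> gT -> k;
  coc_neq0 : forall x y z, coc x y z != 0;
  cocE : forall x y z w,
    coc y z w * coc x (y * z)%g w * coc x y z =
    coc (x * y)%g z w * coc x y (z * w)%g;
  coc_norm : forall x y,
    [/\ coc 1%g x y = 1, coc x 1%g y = 1 & coc x y 1%g = 1] }.

Variable Phi : cocycle3.

Definition Vec : monCat k.
Proof.
apply: (@MonCat k VecLin grtens grtensm _ _ _ _ grunit (twassoc Phi) _ _
  grlunit _ _ grrunit).
- by move=> V W; apply: grtens_ext => x y v w _ _;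
    rewrite /= vtensm_tmul !id_lfunE.
- move=> V V' V'' W W' W'' f' f g' g; apply: grtens_ext => x y v w _ _.
  by rewrite /= comp_lfunE !vtensm_tmul !comp_lfunE.
- move=> V V' W W' f a g h; apply: grtens_ext => x y v w _ _ /=.
  by rewrite add_lfunE scale_lfunE !vtensm_tmul add_lfunE scale_lfunE tmul_linr.
- move=> V V' W W' f a g h; apply: grtens_ext => x y v w _ _ /=.
  by rewrite add_lfunE scale_lfunE !vtensm_tmul add_lfunE scale_lfunE tmul_linl.
- move=> U U' V V' W W' f g h; apply: grtens3_ext => x y z u v w ux vy wz /=.
  rewrite !comp_lfunE !vtensm_tmul (twassoc_tmul _ ux vy wz).
  by rewrite (@twassoc_tmul Phi U' V' W' x y z) ?grhom_mem // linearZ /=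
    !vtensm_tmul.
- move=> U V W; exists (twassoc_inv (fun x y z => (Phi x y z)^-1) U V W).
  split; [apply: grtens3_ext|apply: grtens3r_ext] => x y z u v w ux vy wz /=;
    rewrite comp_lfunE ?(twassoc_tmul _ ux vy wz) ?(twassoc_inv_tmul _ ux vy wz);
    rewrite linearZ /= ?(twassoc_tmul _ ux vy wz) ?(twassoc_inv_tmul _ ux vy wz);
    by rewrite scalerA ?mulfV ?mulVf ?coc_neq0 // scale1r id_lfunE.
- move=> V W f; apply: grtens_ext => x y c v _ _ /=.
  by rewrite !comp_lfunE vtensm_tmul !lunit_lin_tmul linearZ id_lfunE.
- move=> V; exists (grlunit_inv V); split.
    apply: grtens_ext => x y c v _ _ /=.
    rewrite comp_lfunE lunit_lin_tmul lfunE /= id_lfunE.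
    by rewrite tmulZr -tmulZl -[_ *: 1]/(c * 1) mulr1.
  apply: grhom_inj; apply/lfunP => v /=.
  by rewrite comp_lfunE id_lfunE [X in lunit_lin _ X]lfunE /= lunit_lin_tmul scale1r.
- move=> V W f; apply: grtens_ext => x y v c _ _ /=.
  by rewrite !comp_lfunE vtensm_tmul !runit_lin_tmul linearZ id_lfunE.
- move=> V; exists (grrunit_inv V); split.
    apply: grtens_ext => x y v c _ _ /=.
    rewrite comp_lfunE runit_lin_tmul lfunE /= id_lfunE.
    by rewrite /tmulr tmulZl -tmulZr -[_ *: 1]/(c * 1) mulr1.
  apply: grhom_inj; apply/lfunP => v /=.
  by rewrite comp_lfunE id_lfunE [X in runit_lin _ X]lfunE /= runit_lin_tmul scale1r.
- move=> U V W X; apply: grtens4_ext => a b c d u v w x ua vb wc xd /=.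
  have uv := tgr_tmul erefl ua vb; have vw := tgr_tmul erefl vb wc.
  have wx := tgr_tmul erefl wc xd.
  rewrite !comp_lfunE (@twassoc_tmul _ (grtens U V) W X _ _ _ _ _ _ uv wc xd).
  rewrite linearZ /= (@twassoc_tmul _ U V (grtens W X) _ _ _ _ _ _ ua vb wx).
  rewrite vtensm_tmul (twassoc_tmul _ ua vb wc) id_lfunE.
  rewrite tmulZl !linearZ /=.
  rewrite (@twassoc_tmul _ U (grtens V W) X _ _ _ _ _ _ ua vw xd).
  rewrite !linearZ /= vtensm_tmul id_lfunE (twassoc_tmul _ vb wc xd) tmulZr.
  by rewrite !scalerA -cocE -mulrA [in LHS]mulrC.
- move=> V W; apply: grtens3_ext => x y z v c w vx cy wz /=.
  rewrite comp_lfunE (@twassoc_tmul _ V grunit W _ _ _ _ _ _ vx cy wz).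
  rewrite linearZ /= !vtensm_tmul lunit_lin_tmul runit_lin_tmul !id_lfunE.
  have [->|->] := grunitP cy; last by rewrite !scale0r tmul0r tmul0l scaler0.
  by have [_ -> _] := coc_norm Phi x z; rewrite scale1r tmulZl tmulZr.
Defined.

End Graded.

Arguments cocycle3 k gT : clear implicits.

(* The least i with x = g ^+ i. *)
Definition cexp (C : finGroupType) (g x : C) : nat :=
  index x [seq (g ^+ i)%g | i <- iota 0 #[g]%g].

Section Cexp.
Local Open Scope nat_scope.
Variables (C : finGroupType) (g : C).
Hypothesis gen_g : generator [set: C] g.

Lemma cexp_lt x : cexp g x < #|C|.
Proof.
have og : #[g]%g = #|C| by rewrite orderE -(eqP gen_g) cardsT.
have : x \in <[g]>%g by rewrite -(eqP gen_g) inE.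
case/cyclePmin => i io ->; rewrite -og -[X in _ < X](size_iota 0).
rewrite -(size_map (fun i => g ^+ i)%g) index_mem.
by apply: map_f; rewrite mem_iota.
Qed.

Lemma cexpK x : (g ^+ cexp g x)%g = x.
Proof.
have og : #[g]%g = #|C| by rewrite orderE -(eqP gen_g) cardsT.
have lt := cexp_lt x.
have lt' : cexp g x < size (iota 0 #[g]%g) by rewrite size_iota og.
have := nth_index 1%g (x := x) (s := [seq (g ^+ i)%g | i <- iota 0 #[g]%g]).
rewrite -index_mem size_map => /(_ lt').
by rewrite -/(cexp g x) (nth_map 0%N) // nth_iota ?og.
Qed.

Lemma cexp_expg i : i < #|C| -> cexp g (g ^+ i)%g = i.
Proof.
have og : #[g]%g = #|C| by rewrite orderE -(eqP gen_g) cardsT.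
move=> lti; have := cexpK (g ^+ i)%g; move/eqP.
by rewrite eq_expg_mod_order og !modn_small ?cexp_lt // => /eqP.
Qed.

Lemma cexp1 : cexp g 1%g = 0%N.
Proof. by rewrite -(cexp_expg (i := 0)) ?expg0 //; apply/card_gt0P; exists 1%g. Qed.

Lemma cexpM x y : cexp g (x * y)%g = (cexp g x + cexp g y) %% #|C|.
Proof.
have og : #[g]%g = #|C| by rewrite orderE -(eqP gen_g) cardsT.
rewrite -{1}[x]cexpK -{1}[y]cexpK -expgD -(expg_mod_order g) og cexp_expg //.
by rewrite ltn_mod; apply/card_gt0P; exists 1%g.
Qed.

Lemma carryE x y :
  (cexp g x + cexp g y) %/ #|C| * #|C| + cexp g (x * y)%g
    = cexp g x + cexp g y.
Proof. by rewrite cexpM -divn_eq. Qed.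

Lemma carry_cocycle x y z :
  (cexp g y + cexp g z) %/ #|C| + (cexp g x + cexp g (y * z)%g) %/ #|C|
    = (cexp g x + cexp g y) %/ #|C| + (cexp g (x * y)%g + cexp g z) %/ #|C|.
Proof.
have C0 : 0 < #|C| by apply/card_gt0P; exists 1%g.
have e1 := carryE y z; have e2 := carryE x (y * z)%g.
have e3 := carryE x y; have e4 := carryE (x * y)%g z.
apply/eqP; rewrite -(eqn_pmul2r C0) !mulnDl.
rewrite -(eqn_add2r (cexp g (x * y * z)%g)) -[X in _ == X]addnA e4.
by rewrite -mulgA -addnA e2 addnCA e1 [X in _ == X]addnA e3 addnA.
Qed.

End Cexp.

Section PhiABD.
Variables (k : fieldType) (zeta : nat -> k) (Zm Zn : finGroupType).
Variables (g1 : Zm) (g2 : Zn) (a b d : nat).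

Definition PhiABD_fun (x y z : Zm * Zn) : k :=
  let m := #|Zm| in let n := #|Zn| in
  let i := cexp g1 x.1 in let j := cexp g2 x.2 in
  let s := cexp g1 y.1 in let t := cexp g2 y.2 in
  let p := cexp g1 z.1 in let l := cexp g2 z.2 in
  zeta m ^+ (a * ((p + s) %/ m) * i)%N
  * zeta n ^+ (b * ((p + s) %/ m) * j)%N
  * zeta n ^+ (d * ((t + l) %/ n) * j)%N.

Hypothesis zetaP : forall s : nat, (0 < s)%N -> s.-primitive_root (zeta s).
Hypothesis gen_g1 : generator [set: Zm] g1.
Hypothesis gen_g2 : generator [set: Zn] g2.

Lemma PhiABD_funE (i s p j t l : nat) :
  (i < #|Zm|)%N -> (s < #|Zm|)%N -> (p < #|Zm|)%N ->
  (j < #|Zn|)%N -> (t < #|Zn|)%N -> (l < #|Zn|)%N ->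
  PhiABD_fun (g1 ^+ i, g2 ^+ j)%g (g1 ^+ s, g2 ^+ t)%g (g1 ^+ p, g2 ^+ l)%g =
  zeta #|Zm| ^+ (a * ((p + s) %/ #|Zm|) * i)%N
  * zeta #|Zn| ^+ (b * ((p + s) %/ #|Zm|) * j)%N
  * zeta #|Zn| ^+ (d * ((t + l) %/ #|Zn|) * j)%N.
Proof. by move=> *; rewrite /PhiABD_fun /= !cexp_expg. Qed.

Fact PhiABD_neq0 x y z : PhiABD_fun x y z != 0.
Proof.
have z0 s : (0 < s)%N -> zeta s != 0.
  move=> s0; have := prim_expr_order (zetaP s0); apply: contra_eq_neq => ->.
  by rewrite expr0n eqn0Ngt s0 eq_sym oner_neq0.
have m0 : (0 < #|Zm|)%N by apply/card_gt0P; exists 1%g.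
have n0 : (0 < #|Zn|)%N by apply/card_gt0P; exists 1%g.
by rewrite /PhiABD_fun !mulf_neq0 ?expf_neq0 ?z0.
Qed.

(* A factor zeta^(a * carry(y, z) * log x): a character of x to the power of an
   integral 2-cocycle in (y, z). *)
Fact cup_cocycle (C C' : finGroupType) (g : C) (g' : C') (c : nat)
    (x : C') (y z w : C) (y' : C') :
  generator [set: C] g -> generator [set: C'] g' ->
  let e := cexp g in let e' := cexp g' in
  let F (u : C') (v1 v2 : C) :=
    zeta #|C'| ^+ (c * ((e v2 + e v1) %/ #|C|) * e' u)%N in
  F y' z w * F x (y * z)%g w * F x y z = F (x * y')%g z w * F x y (z * w)%g.
Proof.
move=> gg gg' e e' F.
have C'0 : (0 < #|C'|)%N by apply/card_gt0P; exists 1%g.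
have FM u u' v1 v2 : F (u * u')%g v1 v2 = F u v1 v2 * F u' v1 v2.
  rewrite /F /e' cexpM // -exprD -mulnDr mulnC [in RHS]mulnC.
  by rewrite !exprM (prim_expr_mod (zetaP C'0)).
rewrite FM -mulrA [in RHS]mulrAC [in LHS]mulrC; congr (_ * _).
rewrite /F -!exprD -!mulnDl -!mulnDr; congr (_ ^+ (_ * _ * _)).
have := carry_cocycle gg y z w; rewrite -/e => cE.
by rewrite addnC [(e z + e y)%N]addnC [(e w + _ (y * z)%g)%N]addnC -cE
  [(e w + e z)%N]addnC [(e (z * w)%g + e y)%N]addnC.
Qed.

Fact PhiABD_cocE x y z w :
  PhiABD_fun y z w * PhiABD_fun x (y * z)%g w * PhiABD_fun x y z =
  PhiABD_fun (x * y)%g z w * PhiABD_fun x y (z * w)%g.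
Proof.
case: x y z w => [x1 x2] [y1 y2] [z1 z2] [w1 w2].
have A := cup_cocycle a x1 y1 z1 w1 y1 gen_g1 gen_g1.
have B := cup_cocycle b x2 y1 z1 w1 y2 gen_g1 gen_g2.
have D := cup_cocycle d x2 y2 z2 w2 y2 gen_g2 gen_g2.
have mulE (p1 p2 p3 q1 q2 q3 r1 r2 r3 : k) :
    p1 * p2 * p3 * (q1 * q2 * q3) * (r1 * r2 * r3) =
    (p1 * q1 * r1) * (p2 * q2 * r2) * (p3 * q3 * r3) by ring.
rewrite /= in A B D; rewrite /PhiABD_fun mulE /= A B.
rewrite [(cexp g2 z2 + cexp g2 w2)%N]addnC [(cexp g2 y2 + cexp g2 z2)%N]addnC.
rewrite [(cexp g2 (y2 * z2)%g + _)%N]addnC [(_ + cexp g2 (z2 * w2)%g)%N]addnC.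
by rewrite D; ring.
Qed.

Fact PhiABD_norm x y :
  [/\ PhiABD_fun 1%g x y = 1, PhiABD_fun x 1%g y = 1 & PhiABD_fun x y 1%g = 1].
Proof.
have div0 (C : finGroupType) (g u : C) : generator [set: C] g ->
    (cexp g u %/ #|C| = 0)%N by move=> gg; rewrite divn_small ?cexp_lt.
by split; rewrite /PhiABD_fun /= !cexp1 // ?addn0 ?add0n ?div0 //
  ?muln0 ?mul0n ?expr0 ?mulr1.
Qed.

Definition PhiABD : cocycle3 k (Zm * Zn)%type :=
  Cocycle3 PhiABD_neq0 PhiABD_cocE PhiABD_norm.

End PhiABD.

(* Main.v *)
Require Import Defs.
From HB Require Import structures.
From mathcomp Require Import all_boot all_order all_algebra all_fingroup all_solvable.
From mathcomp Require Import ring.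
Set Implicit Arguments.
Unset Strict Implicit.
Unset Printing Implicit Defensive.
Import GRing.Theory.
Local Open Scope ring_scope.

(* Cohomologous cocycles give tensor equivalent categories: the identity functor
   becomes monoidal with the 2-cochain as tensor constraint.

   The cohomology class is then brought to normal form by three gauges. Write
   x = r(x) g^e(x) along a cyclic factor <g> of order N. A cocycle f with
   f(x, y, g) = 1 unless e(y) = N - 1, where it is c(x), satisfies
   f(x, y, z) = f(x, y, r(z)) c(x)^carry(y, z), and f can be given this shape by
   transporting products f(x, r(y) g^i, g) along powers of g. For g = g2 this
   splits off the d-part, after a correction by N-th roots, and leaves a cocycle
   in which z only matters through r(z). Such a cocycle restricts to 2-cocycles
   on <g2>, which are trivial since k^* is divisible; trivializing them makes y
   matter only through r(y) too. The first argument applied to g = g1 then leaves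
   the carry cocycle of a character of the whole group, which gives a and b. *)

(** * Normalized 2-cochains and cohomologous cocycles *)

Record cochain2 (k : fieldType) (gT : finGroupType) := Cochain2 {
  coch :> gT -> gT -> k;
  coch_neq0 : forall x y, coch x y != 0;
  coch_norm : forall x, coch 1%g x = 1 /\ coch x 1%g = 1 }.

Definition cohomologous (k : fieldType) (gT : finGroupType)
    (f f' : cocycle3 k gT) :=
  exists u : cochain2 k gT, forall x y z,
    f x y z * (u (x * y)%g z * u x y) = f' x y z * (u x (y * z)%g * u y z).

(** * Tensor equivalences from 2-cochains *)

Section TensorEquivalence.
Variables (k : fieldType) (gT : finGroupType).
Implicit Types (U V W : grSpace k gT) (c : gT -> gT -> k).

(** Summing over the projections makes the scaling of each bidegree by [c x y] a linear map defined
    on all tensors, not only on homogeneous ones. *)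
Definition twtens_lin c V W : 'End(vtens V W) :=
  \sum_x \sum_y c x y *: vtensm (grproj V x) (grproj W y).

Lemma twtens_tmul c V W x y v w :
  v \in gr V x -> w \in gr W y ->
  twtens_lin c V W (tmul v w) = c x y *: tmul v w.
Proof.
move=> vx wy; rewrite /twtens_lin sum_lfunE (bigD1 x) //= [X in _ + X]big1.
  rewrite addr0 sum_lfunE (bigD1 y) //= [X in _ + X]big1.
    rewrite addr0 scale_lfunE vtensm_tmul.
    by rewrite (grproj_id _ vx) (grproj_id _ wy) !eqxx.
  move=> y' /negbTE ny; rewrite scale_lfunE vtensm_tmul (grproj_id _ wy) ny.
  by rewrite tmul0r scaler0.
move=> x' /negbTE nx; rewrite sum_lfunE big1 // => y' _.
by rewrite scale_lfunE vtensm_tmul (grproj_id _ vx) nx tmul0l scaler0.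
Qed.

Fact twtens_graded c V W : twtens_lin c V W 
  \in @is_graded k gT (grtens V W) (grtens V W).
Proof.
apply: grtens_graded => x y v w vx wy; rewrite (twtens_tmul _ vx wy) rpredZ //.
exact: (@tgr_tmul _ _ V W x y).
Qed.
Definition twtens c V W : grHom (grtens V W) (grtens V W) :=
  GrHom (twtens_graded c V W).

Variables (f f' : cocycle3 k gT) (u : cochain2 k gT).
Hypothesis uE : forall x y z,
  f x y z * (u (x * y)%g z * u x y) = f' x y z * (u x (y * z)%g * u y z).

Definition tw_linFunctor : linFunctor (Vec f) (Vec f').
Proof. by exists (fun V => V) (fun V W g => g). Defined.

Definition tw_monFunctor : monFunctor (Vec f) (Vec f').
Proof.
apply: (@MonFunctor k (Vec f) (Vec f') tw_linFunctor (fun V W => twtens u V W)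
  _ _ (grid (grunit k gT))).
- move=> V V' W W' g h; apply: grtens_ext => x y v w vx wy /=.
  rewrite !comp_lfunE !vtensm_tmul (twtens_tmul _ vx wy) linearZ /= vtensm_tmul.
  by rewrite (@twtens_tmul u V' W' x y) ?grhom_mem.
- move=> V W; exists (twtens (fun x y => (u x y)^-1) V W).
  by split; apply: grtens_ext => x y v w vx wy /=;
    rewrite !comp_lfunE (twtens_tmul _ vx wy) linearZ /= (twtens_tmul _ vx wy);
    rewrite scalerA ?mulfV ?mulVf ?coch_neq0 // scale1r id_lfunE.
- by exists (grid (grunit k gT)); split;
    apply: grhom_inj; rewrite /= comp_lfun1l.
- move=> U V W; apply: grtens3_ext => x y z a v w ax vy wz /=.
  have av := tgr_tmul erefl ax vy; have vw := tgr_tmul erefl vy wz.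
  rewrite !comp_lfunE !vtensm_tmul (twtens_tmul _ ax vy) tmulZl !linearZ /=.
  rewrite id_lfunE (@twtens_tmul u (grtens U V) W _ _ _ _ av wz) !linearZ /=.
  rewrite !(twassoc_tmul _ ax vy wz) !linearZ /= vtensm_tmul.
  rewrite id_lfunE (twtens_tmul _ vy wz) tmulZr !linearZ /=.
  rewrite (@twtens_tmul u U (grtens V W) _ _ _ _ ax vw) !scalerA.
  (* On homogeneous vectors the associativity axiom of a monoidal functor is exactly the coboundary
     relation [uE]. *)
  by congr (_ *: _); rewrite -mulrA uE; ring.
- move=> V; apply: grtens_ext => x y c v cx vy /=.
  rewrite !comp_lfunE vtensm_tmul !id_lfunE.
  rewrite (@twtens_tmul u (grunit k gT) V x y) //.
  rewrite linearZ /= lunit_lin_tmul.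
  have [->|->] := grunitP cx; last by rewrite !scale0r scaler0.
  by have [-> _] := coch_norm u y; rewrite scale1r.
- move=> V; apply: grtens_ext => x y v c vx cy /=.
  rewrite !comp_lfunE vtensm_tmul !id_lfunE.
  rewrite (@twtens_tmul u V (grunit k gT) x y) //.
  rewrite linearZ /= runit_lin_tmul.
  have [->|->] := grunitP cy; last by rewrite !scale0r scaler0.
  by have [_ ->] := coch_norm u x; rewrite scale1r.
Defined.

End TensorEquivalence.

Lemma cohomologous_tensor_equivalent (k : fieldType) (gT : finGroupType)
    (f f' : cocycle3 k gT) :
  cohomologous f f' -> tensor_equivalent (Vec f) (Vec f').
Proof.
case=> u uE; exists (tw_monFunctor uE).
have idiso (C : linCat k) (X : C) : is_isom (idmor X).
  by exists (idmor X); rewrite comp1m.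
exists (tw_linFunctor f' f); split.
  by exists (fun X : Vec f => idmor X); split=> // X Y g; rewrite comp1m compm1.
by exists (fun X : Vec f' => idmor X); split=> // X Y g; rewrite comp1m compm1.
Qed.

(** * Products, inverses and gauge transforms of cocycles *)

Section CocycleGroup.
Variables (k : fieldType) (gT : finGroupType).
Implicit Types (f : cocycle3 k gT) (u : cochain2 k gT).

Definition cocycle_mul f1 f2 : cocycle3 k gT.
Proof.
apply: (@Cocycle3 k gT (fun x y z => f1 x y z * f2 x y z)) => [x y z|x y z w|x y].
- by rewrite mulf_neq0 ?coc_neq0.
- transitivity ((f1 y z w * f1 x (y * z)%g w * f1 x y z) *
    (f2 y z w * f2 x (y * z)%g w * f2 x y z)); first by ring.
  by rewrite !cocE; ring.
- by have [-> -> ->] := coc_norm f1 x y; have [-> -> ->] := coc_norm f2 x y;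
    rewrite mulr1.
Defined.

Definition cocycle_inv f : cocycle3 k gT.
Proof.
apply: (@Cocycle3 k gT (fun x y z => (f x y z)^-1)) => [x y z|x y z w|x y].
- by rewrite invr_eq0 coc_neq0.
- by rewrite -!invfM cocE.
- by have [-> -> ->] := coc_norm f x y; rewrite invr1.
Defined.

(** The quotient is the coboundary of [u]; it satisfies the cocycle identity by cancellation
    alone. *)
Definition gauge f u : cocycle3 k gT.
Proof.
apply: (@Cocycle3 k gT (fun x y z => f x y z *
  ((u (x * y)%g z * u x y) / (u x (y * z)%g * u y z)))) => [x y z|x y z w|x y].
- by rewrite !(mulf_neq0, invr_neq0, coc_neq0, coch_neq0).
- pose du (x y z : gT) := u (x * y)%g z * u x y / (u x (y * z)%g * u y z).
  transitivity ((f y z w * f x (y * z)%g w * f x y z) *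
    (du y z w * du x (y * z)%g w * du x y z)); first by rewrite /du; ring.
  by rewrite cocE /du !mulgA; field; rewrite !coch_neq0.
- have [-> -> ->] := coc_norm f x y.
  have [ux xu] := coch_norm u x; have [uy yu] := coch_norm u y.
  have [uxy xyu] := coch_norm u (x * y)%g.
  by rewrite !mulg1 !mul1g ?ux ?xu ?uy ?yu ?uxy ?xyu; split; field;
    rewrite ?coch_neq0.
Defined.

Lemma cohomologous_gauge f u : cohomologous f (gauge f u).
Proof. by exists u => x y z /=; field; rewrite !coch_neq0. Qed.

Lemma cohomologous_eq f f' :
  (forall x y z, f x y z = f' x y z) -> cohomologous f f'.
Proof.
have one : forall x : gT, (1 : k) = 1 /\ (1 : k) = 1 by [].
move=> ff'; exists (Cochain2 (fun _ _ => oner_neq0 k) one) => x y z.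
by rewrite /= ff'.
Qed.

Lemma cohomologous_trans f2 f1 f3 :
  cohomologous f1 f2 -> cohomologous f2 f3 -> cohomologous f1 f3.
Proof.
move=> [u uE] [v vE].
unshelve eexists (@Cochain2 k gT (fun x y => u x y * v x y) _ _)
  => [x y|x|x y z /=].
- by rewrite mulf_neq0 ?coch_neq0.
- by have [-> ->] := coch_norm u x; have [-> ->] := coch_norm v x; rewrite mulr1.
- transitivity ((f1 x y z * (u (x * y)%g z * u x y)) * (v (x * y)%g z * v x y)).
    by ring.
  rewrite uE; transitivity ((f2 x y z * (v (x * y)%g z * v x y)) *
    (u x (y * z)%g * u y z)); first by ring.
  by rewrite vE; ring.
Qed.

Lemma cohomologous_mul f1 f2 f : cohomologous f1 f2 ->
  cohomologous (cocycle_mul f1 f) (cocycle_mul f2 f).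
Proof.
move=> [u uE]; exists u => x y z /=.
by rewrite mulrAC uE mulrAC.
Qed.

End CocycleGroup.

(** * Roots in an algebraically closed field *)

Section NthRoot.
Variable k : closedFieldType.

Lemma exists_root N (a : k) : (0 < N)%N -> exists z, z ^+ N == a.
Proof.
move=> N0; have /closed_rootP[z] : size ('X^N - a%:P : {poly k}) != 1%N.
  by rewrite size_XnsubC // eqSS -lt0n.
by rewrite rootE !hornerE subr_eq0 => zN; exists z.
Qed.

(* The root of 1 is taken to be 1, which keeps cochains normalized. *)
Definition nroot N (N_gt0 : (0 < N)%N) (a : k) : k :=
  if a == 1 then 1 else xchoose (exists_root a N_gt0).

Lemma nrootK N (N_gt0 : (0 < N)%N) a : nroot N_gt0 a ^+ N = a.
Proof.
rewrite /nroot; case: eqP => [->|_]; first exact: expr1n.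
exact/eqP/(xchooseP (exists_root a N_gt0)).
Qed.

Lemma nroot1 N (N_gt0 : (0 < N)%N) : nroot N_gt0 1 = 1.
Proof. by rewrite /nroot eqxx. Qed.

Lemma nroot_neq0 N (N_gt0 : (0 < N)%N) a : a != 0 -> nroot N_gt0 a != 0.
Proof. by rewrite -{1}(nrootK N_gt0 a) expf_eq0 N_gt0. Qed.

End NthRoot.

(* A semidirect decomposition with cyclic factor: [cf_base] is the retraction
   onto the other factor, with kernel <[cf_gen]>. *)
Record cyclic_factor (gT : finGroupType) := CyclicFactor {
  cf_gen : gT;
  cf_order : nat;
  cf_exp : gT -> nat;
  cf_base : gT -> gT;
  cf_exp_lt : forall x, (cf_exp x < cf_order)%N;
  cf_exp_gen : cf_exp cf_gen = (1 %% cf_order)%N;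
  cf_expM : forall x y, cf_exp (x * y)%g = ((cf_exp x + cf_exp y) %% cf_order)%N;
  cf_baseM : {morph cf_base : x y / (x * y)%g};
  cf_base_gen : cf_base cf_gen = 1%g;
  cf_split : forall x, x = (cf_base x * cf_gen ^+ cf_exp x)%g }.

(** * Exponents and bases along a cyclic factor *)

Section CyclicFactor.
Variables (gT : finGroupType) (C : cyclic_factor gT).
Local Notation g := (cf_gen C).
Local Notation N := (cf_order C).
Local Notation e := (cf_exp C).
Local Notation r := (cf_base C).

Lemma cf_order_gt0 : (0 < N)%N.
Proof. exact: leq_ltn_trans (leq0n _) (cf_exp_lt C 1%g). Qed.

Lemma cf_base1 : r 1%g = 1%g.
Proof. by apply: (mulgI (r 1%g)); rewrite -cf_baseM !mulg1. Qed.

Lemma cf_baseX i : r (g ^+ i)%g = 1%g.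
Proof.
by elim: i => [|i IH]; rewrite ?cf_base1 // expgS cf_baseM cf_base_gen IH mulg1.
Qed.

Lemma cf_base_id x : r (r x) = r x.
Proof. by rewrite [in RHS](cf_split C x) cf_baseM cf_baseX mulg1. Qed.

Lemma cf_baseMg x : r (x * g)%g = r x.
Proof. by rewrite cf_baseM cf_base_gen mulg1. Qed.

(** Cancellation modulo N; it forces the exponents of 1 and of base elements to vanish. *)
Lemma cf_exp_mod0 x i : e x = ((i + e x) %% N)%N -> (i %% N = 0)%N.
Proof.
move=> ex; apply/eqP.
rewrite -[X in _ == X](mod0n N) -(eqn_modDr (e x)) -ex add0n.
by rewrite modn_small ?cf_exp_lt.
Qed.

Lemma cf_exp1 : e 1%g = 0%N.
Proof.
by rewrite -(modn_small (cf_exp_lt C 1%g)) (@cf_exp_mod0 1%g) // -cf_expM mulg1.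
Qed.

Lemma cf_expX i : e (g ^+ i)%g = (i %% N)%N.
Proof.
elim: i => [|i IH]; first by rewrite cf_exp1 mod0n.
by rewrite expgSr cf_expM IH cf_exp_gen modnDm addn1.
Qed.

Lemma cf_exp_base x : e (r x) = 0%N.
Proof.
rewrite -(modn_small (cf_exp_lt C (r x))) (@cf_exp_mod0 x) //.
by rewrite {1}(cf_split C x) cf_expM cf_expX (modn_small (cf_exp_lt C x)).
Qed.

Lemma cf_expMg x : e (x * g)%g = ((e x).+1 %% N)%N.
Proof. by rewrite cf_expM cf_exp_gen modnDmr addn1. Qed.

Lemma cf_expMX x i : e (r x * g ^+ i)%g = (i %% N)%N.
Proof. by rewrite cf_expM cf_exp_base cf_expX add0n modn_mod. Qed.

Lemma cf_genX_order : (g ^+ N = 1)%g.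
Proof. by rewrite [LHS](cf_split C) cf_baseX cf_expX modnn expg0 mulg1. Qed.

End CyclicFactor.

(** Both sides times [F 0] give the product of the first n + 1 values. It serves to reindex products
    round a full cycle of powers of [g]. *)
Lemma prod_ord_shift (k : fieldType) (F : nat -> k) n :
  (forall i, F i != 0) -> F n = F 0%N ->
  \prod_(i < n) F i.+1 = \prod_(i < n) F i.
Proof.
move=> F0 Fn; apply: (mulfI (F0 0%N)).
transitivity (\prod_(i < n.+1) F i); first by rewrite big_ord_recl.
by rewrite big_ord_recr /= Fn mulrC.
Qed.

Lemma divnS_carry N i : (0 < N)%N ->
  ((i.+1 %/ N = i %/ N + ((i %% N).+1 == N))%N).
Proof.
move=> N0; rewrite divnS // addnC; congr (_ + nat_of_bool _)%N.
rewrite /dvdn -addn1 -modnDml addn1.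
have : ((i %% N).+1 <= N)%N by rewrite ltn_mod.
rewrite leq_eqVlt => /orP[/eqP ->|lt]; first by rewrite modnn !eqxx.
by rewrite modn_small // (ltn_eqF lt).
Qed.

(** * Norms and gauge transforms along a cyclic factor *)

Section CyclicGauge.
Variables (k : fieldType) (gT : finGroupType) (C : cyclic_factor gT).
Variable f : cocycle3 k gT.
Local Notation g := (cf_gen C).
Local Notation N := (cf_order C).
Local Notation e := (cf_exp C).
Local Notation r := (cf_base C).

Definition cyc_norm (x w : gT) : k := \prod_(i < N) f x (w * g ^+ i)%g g.

Lemma cyc_norm_neq0 x w : cyc_norm x w != 0.
Proof. by apply/prodf_neq0 => i _; apply: coc_neq0. Qed.

Lemma cyc_norm1 w : cyc_norm 1%g w = 1.
Proof.
by rewrite /cyc_norm big1 // => i _; have [->] := coc_norm f (w * g ^+ i)%g g.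
Qed.

Lemma cyc_normMg x w : cyc_norm x (w * g)%g = cyc_norm x w.
Proof.
rewrite /cyc_norm -(prod_ord_shift (F := fun i => f x (w * g ^+ i)%g g)) ?mulg1.
- by apply: eq_bigr => i _; rewrite expgS mulgA.
- by move=> i; apply: coc_neq0.
- by rewrite cf_genX_order mulg1.
Qed.

(** Multiply the cocycle identities at (x, y, z g^i, g) over all i: the factors f(x, y, z g^i) and
    f(x, y, z g^(i+1)) have the same product round the cycle and cancel. *)
Lemma cyc_norm_cocycle x y z :
  cyc_norm y z * cyc_norm x (y * z)%g = cyc_norm (x * y)%g z.
Proof.
pose F i := f x y (z * g ^+ i)%g.
have F0 i : F i != 0 by apply: coc_neq0.
have /mulIf : \prod_(i < N) F i != 0 by apply/prodf_neq0 => i _.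
apply; rewrite -{2}(prod_ord_shift (F := F)) // /F ?cf_genX_order //.
rewrite -!big_split; apply: eq_bigr => i _ /=.
by rewrite expgSr !mulgA -cocE !mulgA.
Qed.

Lemma cyc_norm_base x y : cyc_norm x (r y) = cyc_norm x y.
Proof.
rewrite [in RHS](cf_split C y); elim: (e y) => [|i IH]; first by rewrite mulg1.
by rewrite expgSr mulgA cyc_normMg.
Qed.

(** Collects one factor per step of [g] on the way from [r y] to [y]. The ratio of values of [w]
    spreads an N-th root correction evenly over the steps. *)
Definition cyc_cochain (w : gT -> k) (x y : gT) : k :=
  \prod_(i < e y) (f x (r y * g ^+ i)%g g * (w (x * y)%g / w y)).

Section Gauge.
Variable w : gT -> k.
Hypothesis w_neq0 : forall x, w x != 0.
Hypothesis w_base : forall x, w (r x) = w x.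
Hypothesis w1 : w 1%g = 1.
Hypothesis w_triv : N = 1%N -> forall x, w x = 1.

Fact cyc_cochain_neq0 x y : cyc_cochain w x y != 0.
Proof.
by apply/prodf_neq0 => i _; rewrite !mulf_neq0 ?invr_neq0 ?coc_neq0.
Qed.

Fact cyc_cochain_norm x : cyc_cochain w 1%g x = 1 /\ cyc_cochain w x 1%g = 1.
Proof.
split; last by rewrite /cyc_cochain cf_exp1 big_ord0.
rewrite /cyc_cochain big1 // => i _.
have [-> _ _] := coc_norm f (r x * g ^+ i)%g g.
by rewrite !mul1g divff // mulr1.
Qed.

Definition cyc_cochain2 : cochain2 k gT :=
  Cochain2 cyc_cochain_neq0 cyc_cochain_norm.

Lemma w_baseMg x y : w (x * (y * g))%g = w (x * y)%g.
Proof. by rewrite mulgA -w_base cf_baseMg w_base. Qed.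

Lemma w_gen x : w (x * g)%g = w x.
Proof. by rewrite -w_base cf_baseMg w_base. Qed.

Lemma cyc_cochain_gen x : cyc_cochain w x g = w x.
Proof.
rewrite /cyc_cochain cf_exp_gen cf_base_gen.
(* For N = 1 the exponent of [g] is 0, the product is empty, and the value must be 1: this is where
   [w_triv] enters. *)
have [N1|N1] := eqVneq N 1%N; first by rewrite N1 modnn big_ord0 w_triv.
have N2 : (1 < N)%N by case: (N) (cf_order_gt0 C) N1 => [|[]].
rewrite modn_small // big_ord1 expg0 mulg1; have [_ -> _] := coc_norm f x g.
by rewrite w_gen -[X in w x / w X]mul1g w_gen w1 divr1 mul1r.
Qed.

(** Passing from y to y g appends a factor to the cochain, which cancels [f x y g]. When the
    exponent wraps round to 0 the cochain restarts at the empty product, so all N factors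
    survive. *)
Lemma gauge_cyc_gen x y : gauge f cyc_cochain2 x y g =
  (cyc_norm x y * (w (x * y)%g / w y) ^+ N) ^+ ((e y).+1 == N).
Proof.
rewrite /= !cyc_cochain_gen.
have w0 := w_neq0; have u0 := cyc_cochain_neq0; have f0 := coc_neq0 f.
have stepE : f x y g * (w (x * y)%g / w y) * cyc_cochain w x y =
    \prod_(i < (e y).+1) (f x (r y * g ^+ i)%g g * (w (x * y)%g / w y)).
  by rewrite big_ord_recr /= -cf_split mulrC.
have uyg : cyc_cochain w x (y * g)%g = if (e y).+1 == N then 1 else
    f x y g * (w (x * y)%g / w y) * cyc_cochain w x y.
  rewrite stepE /cyc_cochain cf_expMg cf_baseMg w_baseMg w_gen.
  have := cf_exp_lt C y; rewrite leq_eqVlt => /orP[/eqP ->|lt].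
    by rewrite modnn big_ord0 eqxx.
  by rewrite modn_small // (ltn_eqF lt).
rewrite uyg; case: eqP => [eN|_] /=; last first.
  by rewrite expr0; field; rewrite !w0 u0 f0.
rewrite expr1 -cyc_norm_base /cyc_norm -[X in _ ^+ X]card_ord -prodr_const.
rewrite -big_split /= -[in RHS]eN -stepE; field; exact: w0.
Qed.

End Gauge.

(** Induction on the exponent of z by the cocycle identity at (x, y, z', g): without wrap-around two
    of its factors are 1, and f(x, y z', g) contributes [c x] exactly when the carry grows. *)
Lemma cocycle_gen_determines (c : gT -> k) :
  (forall x y, f x y g = c x ^+ ((e y).+1 == N)) ->
  forall x y z, f x y z = f x y (r z) * c x ^+ ((e y + e z) %/ N)%N.
Proof.
move=> fg x y z; rewrite {1}[z](cf_split C).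
have := cf_exp_lt C z; elim: (e z) => [_|l IH lN].
  by rewrite mulg1 addn0 divn_small ?cf_exp_lt // mulr1.
rewrite expgSr mulgA.
have fzl t : f t (r z * g ^+ l)%g g = 1.
  by rewrite fg cf_expMX modn_small 1?ltnW // (ltn_eqF lN).
have := cocE f x y (r z * g ^+ l)%g g; rewrite !fzl !mul1r => <-.
rewrite fg IH 1?ltnW // cf_expM cf_expMX modnDmr.
rewrite addnS divnS_carry ?cf_order_gt0 // exprD mulrCA; congr (_ * _).
by rewrite mulrC.
Qed.

End CyclicGauge.

(** * Reduction of the third and second arguments *)

Section Reduction.
Variables (k : closedFieldType) (gT : finGroupType) (C : cyclic_factor gT).
Local Notation g := (cf_gen C).
Local Notation N := (cf_order C).
Local Notation e := (cf_exp C).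
Local Notation r := (cf_base C).
Implicit Types f : cocycle3 k gT.

(** The norm is the coboundary of [p], which factors as [p (r x)] times a power of [p g]. The first
    factor is removed by N-th roots; [p g] is an N-th root of unity and remains as [chi]. *)
Lemma split_off_cyclic f : exists f' (chi : k),
  [/\ cohomologous f f', chi ^+ N = 1 &
      forall x y z, f' x y z = f' x y (r z) * chi ^+ (e x * ((e y + e z) %/ N))].
Proof.
pose p x := cyc_norm C f x 1%g.
have p0 x : p x != 0 by apply: cyc_norm_neq0.
have p1 : p 1%g = 1 by apply: cyc_norm1.
have normE x y : cyc_norm C f x y = p (x * y)%g / p y.
  by rewrite /p -cyc_norm_cocycle mulg1 mulrC mulKf ?cyc_norm_neq0.
(* The norm is unchanged when its second argument moves by [g], so p(y g) / p(g) = p(y). *)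
have pMX x i : p (x * g ^+ i)%g = p x * p g ^+ i.
  elim: i => [|i IH]; first by rewrite mulg1 mulr1.
  rewrite expgSr mulgA exprSr mulrA -IH.
  have := normE (x * g ^+ i)%g g.
  rewrite -[X in cyc_norm _ _ _ X]mul1g cyc_normMg.
  by rewrite -/(p _) => ->; rewrite divfK.
have pE x : p x = p (r x) * p g ^+ e x by rewrite {1}(cf_split C x) pMX.
have pgN : p g ^+ N = 1 by rewrite -[LHS]mul1r -p1 -pMX mul1g cf_genX_order.
pose w x := nroot (cf_order_gt0 C) (p (r x))^-1.
have w0 x : w x != 0 by rewrite nroot_neq0 ?invr_eq0.
have wr x : w (r x) = w x by rewrite /w cf_base_id.
have w1 : w 1%g = 1 by rewrite /w cf_base1 p1 invr1 nroot1.
have wt : N = 1%N -> forall x, w x = 1.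
  move=> N1 x; rewrite -[LHS](expr1 (w x)) -[X in _ ^+ X]N1 nrootK.
  have -> : p (r x) = 1; last exact: invr1.
  rewrite /p /cyc_norm N1 big_ord1 mulg1.
  have -> : g = 1%g by rewrite -(cf_genX_order C) N1.
  by have [] := coc_norm f (r x) 1%g.
exists (gauge f (cyc_cochain2 C f w0)), (p g); split=> //.
  exact: cohomologous_gauge.
move=> x y z; rewrite exprM.
apply: (cocycle_gen_determines (c := fun x => p g ^+ e x)) => {}x {}y.
rewrite gauge_cyc_gen //; congr (_ ^+ _).
(* Evaluating the norm at [r y] instead of y leaves [e x] as the only exponent of [p g]. *)
rewrite exprMn exprVn !nrootK -cyc_norm_base normE pE [p (r y)]pE.
rewrite cf_exp_base cf_base_id cf_baseM cf_base_id -cf_baseM.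
rewrite cf_expM cf_exp_base addn0 modn_small ?cf_exp_lt // expr0 mulr1.
by rewrite invrK; field; rewrite !p0.
Qed.

(** For fixed w, f(-, -, w) obeys the 2-cocycle identity whenever its last group element is a power
    of [g]. The cochain [b w] trivializes it against [g], after which moving y by [g] has no
    effect. *)
Lemma reduce_second f : (forall x y z, f x y (r z) = f x y z) ->
  exists2 f', cohomologous f f' & forall x y z, f' x (r y) (r z) = f' x y z.
Proof.
move=> fr; have f0 := coc_neq0 f.
have frg x y i : f x y (g ^+ i)%g = 1.
  by rewrite -fr cf_baseX; have [] := coc_norm f x y.
have fstep x i w : f (g ^+ i)%g g w * f x (g ^+ i.+1)%g w =
    f (x * g ^+ i)%g g w * f x (g ^+ i)%g w.
  have := cocE f x (g ^+ i)%g g w; rewrite (frg x _ 1%N) mulr1 -expgSr => ->.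
  by congr (_ * _); rewrite -fr cf_baseM cf_base_gen mul1g fr.
(* Independent of x, since the 2-cocycle identity telescopes along powers of g. *)
pose T x w := \prod_(j < N) f (r x * g ^+ j)%g g w.
have TE x w : T x w = T 1%g w.
  have /mulIf : \prod_(j < N) f (r x) (g ^+ j)%g w != 0.
    by apply/prodf_neq0 => i _.
  apply; rewrite /T cf_base1.
  rewrite -[in RHS](prod_ord_shift (F := fun i => f (r x) (g ^+ i)%g w)) //.
    by rewrite -!big_split; apply: eq_bigr => i _ /=; rewrite mul1g fstep.
  by rewrite cf_genX_order.
(* At the wrap-around [b w] returns to 1, so N equal steps [gam w] must multiply to the full product
   [T]. *)
pose gam w := nroot (cf_order_gt0 C) (T 1%g (r w)).
have T0 x w : T x w != 0 by apply/prodf_neq0 => i _.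
have gam0 w : gam w != 0 by apply: nroot_neq0.
pose b w x := gam w ^+ e x / \prod_(j < e x) f (r x * g ^+ j)%g g w.
have P0 n x w : \prod_(j < n) f (r x * g ^+ j)%g g w != 0.
  by apply/prodf_neq0 => i _.
have b0 w x : b w x != 0 by rewrite mulf_neq0 ?invr_neq0 ?expf_neq0.
have br w x : b (r w) x = b w x.
  rewrite /b /gam cf_base_id; congr (_ / _).
  by apply: eq_bigr => i _; rewrite fr.
have b_1 w : b w 1%g = 1 by rewrite /b cf_exp1 big_ord0 divr1.
have b1 x : b 1%g x = 1.
  have T1 y n : \prod_(j < n) f (r y * g ^+ j)%g g 1%g = 1.
    by apply: big1 => i _; have [] := coc_norm f (r y * g ^+ i)%g g.
  by rewrite /b T1 divr1 /gam /T cf_base1 -{1}(cf_base1 C) T1 nroot1 expr1n.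
have bg w : b w g = gam w.
  rewrite /b cf_exp_gen cf_base_gen; have [N1|N1] := eqVneq N 1%N.
    have -> : (1 %% N = 0)%N by rewrite N1.
    rewrite big_ord0 divr1 expr0 /gam.
    have g1 : g = 1%g by rewrite -(cf_genX_order C) N1.
    have -> : T 1%g (r w) = 1; last by rewrite nroot1.
    apply: big1 => i _; rewrite g1.
    by have [] := coc_norm f (r 1%g * 1 ^+ i)%g (r w).
  have N2 : (1 < N)%N by case: (N) (cf_order_gt0 C) N1 => [|[]].
  rewrite modn_small // big_ord1 mul1g; have [-> _ _] := coc_norm f g w.
  by rewrite divr1.
have bE w x : b w (x * g)%g * f x g w = b w x * b w g.
  rewrite bg {1}/b cf_baseMg cf_expMg.
  have : (e x < N)%N := cf_exp_lt C x; rewrite leq_eqVlt => /orP[/eqP eN|lt].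
    rewrite eN modnn big_ord0 divr1 expr0 mul1r /b mulrAC -exprSr eN nrootK.
    rewrite -[T 1%g _](TE x) /T -eN big_ord_recr /= -cf_split !fr.
    under [X in X * _ / _]eq_bigr do rewrite fr.
    by rewrite mulrAC divff ?mul1r ?P0.
  rewrite modn_small // big_ord_recr /= -cf_split /b exprSr.
  by field; rewrite f0 P0.
(* The parameter w of [b] is the second argument of the cochain, hence the swap. *)
unshelve eexists (gauge f (@Cochain2 k gT (fun x y => b y x) _ _)) => //.
  exact: cohomologous_gauge.
set f' := gauge _ _.
have f'r x y z : f' x y (r z) = f' x y z.
  rewrite /= fr !br; congr (_ * (_ / (_ * _))).
  by rewrite -br cf_baseM cf_base_id -cf_baseM br.
have f'g x w : f' x g w = 1.
  rewrite /= -[b g x]br cf_base_gen b1 mulr1.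
  rewrite -[b (g * w)%g x]br cf_baseM cf_base_gen mul1g.
  by rewrite br -bE; field; rewrite !b0 f0.
have f'g1 x y : f' x y g = 1.
  by rewrite -f'r cf_base_gen; have [] := coc_norm f' x y.
(* In the cocycle identity at (x, y, g, z) every factor with [g] as an entry is 1. *)
have f'Mg x y z : f' x (y * g)%g z = f' x y z.
  have := cocE f' x y g z; rewrite !f'g f'g1 !mul1r mulr1 => ->.
  by rewrite -f'r cf_baseM cf_base_gen mul1g f'r.
move=> x y z; rewrite f'r [in RHS](cf_split C y).
elim: (e y) => [|i IH]; first by rewrite mulg1.
by rewrite expgSr mulgA f'Mg.
Qed.

(** Invariance in y makes the norm independent of its second argument, so [cyc_norm_cocycle] turns
    it into a character; no root correction is needed and [w] is 1. *)
Lemma reduce_third f (inv_y : forall x y z w, f x (r y * z)%g w = f x z w)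
    (inv_z : forall x y z w, f x y (r z * w)%g = f x y w) :
  exists f' (c : gT -> k),
  [/\ cohomologous f f', c 1%g = 1, {morph c : x y / (x * y)%g >-> x * y} &
      forall x y z, f' x y z = c x ^+ ((e y + e z) %/ N)].
Proof.
pose p x := cyc_norm C f x 1%g.
have normE x y : cyc_norm C f x y = p x.
  rewrite -cyc_norm_base -[r y]mulg1; apply: eq_bigr => i _.
  by rewrite -mulgA inv_y.
have w0 (x : gT) : (1 : k) != 0 := oner_neq0 k.
set f' := gauge f (cyc_cochain2 C f w0).
exists f', p; split; [exact: cohomologous_gauge|exact: cyc_norm1|..].
  by move=> x y; rewrite /p -cyc_norm_cocycle !normE mulrC.
have f'r x y z : f' x y (r z) = 1.
  have ur t : cyc_cochain C f (fun=> 1) t (r z) = 1.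
    by rewrite /cyc_cochain cf_exp_base big_ord0.
  have uyr : cyc_cochain C f (fun=> 1) x (y * r z)%g =
      cyc_cochain C f (fun=> 1) x y.
    rewrite /cyc_cochain cf_expM cf_exp_base addn0 modn_small ?cf_exp_lt //.
    by apply: eq_bigr => i _; rewrite !inv_y.
  rewrite /= !ur uyr mulr1 mul1r divff ?mulr1; last exact: cyc_cochain_neq0.
  by rewrite -[r z]mulg1 inv_z; have [] := coc_norm f x y.
move=> x y z; rewrite -[RHS]mul1r -(f'r x y z).
apply: (cocycle_gen_determines (C := C)) => {}x {}y.
by rewrite gauge_cyc_gen // normE divr1 expr1n mulr1.
Qed.

End Reduction.

Lemma expg_pair (G H : finGroupType) (x : G) (y : H) i :
  ((x, y) ^+ i = (x ^+ i, y ^+ i))%g.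
Proof. by elim: i => // i IH; rewrite !expgS IH. Qed.

Lemma cexp_gen (G : finGroupType) (g : G) :
  generator [set: G] g -> cexp g g = (1 %% #|G|)%N.
Proof.
move=> gg; have [G1|G1] := ltnP 1 #|G|.
  by rewrite modn_small // -[in LHS](expg1 g) cexp_expg.
have G_1 : #|G| = 1%N.
  by apply/eqP; rewrite eqn_leq G1; apply/card_gt0P; exists 1%g.
by have := cexp_lt gg g; rewrite G_1 modnn ltnS leqn0 => /eqP.
Qed.

(** * Normal forms on a product of two cyclic groups *)

Section ProductOfCyclic.
Variables (Zm Zn : finGroupType) (g1 : Zm) (g2 : Zn).
Hypothesis gen_g1 : generator [set: Zm] g1.
Hypothesis gen_g2 : generator [set: Zn] g2.
Local Notation m := #|Zm|.
Local Notation n := #|Zn|.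

Definition cyclic_factor1 : cyclic_factor (Zm * Zn)%type.
Proof.
apply: (@CyclicFactor _ (g1, 1%g) m (fun x => cexp g1 x.1) (fun x => (1%g, x.2))).
- by move=> x; apply: cexp_lt.
- exact: cexp_gen.
- by move=> x y; apply: cexpM.
- by move=> x y; congr (_, _); rewrite mulg1.
- by [].
- by case=> x y; rewrite expg_pair cexpK // expg1n; congr (_, _);
    rewrite ?mul1g ?mulg1.
Defined.

Definition cyclic_factor2 : cyclic_factor (Zm * Zn)%type.
Proof.
apply: (@CyclicFactor _ (1%g, g2) n (fun x => cexp g2 x.2) (fun x => (x.1, 1%g))).
- by move=> x; apply: cexp_lt.
- exact: cexp_gen.
- by move=> x y; apply: cexpM.
- by move=> x y; congr (_, _); rewrite mulg1.
- by [].
- by case=> x y; rewrite expg_pair cexpK // expg1n; congr (_, _);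
    rewrite ?mul1g ?mulg1.
Defined.

Variables (k : closedFieldType) (zeta : nat -> k).
Hypothesis zetaP : forall s : nat, (0 < s)%N -> s.-primitive_root (zeta s).

Let m_gt0 : (0 < m)%N. Proof. by apply/card_gt0P; exists 1%g. Qed.
Let n_gt0 : (0 < n)%N. Proof. by apply/card_gt0P; exists 1%g. Qed.

(** The values at the two generators are an m-th and an n-th root of unity, and they determine the
    character. *)
Lemma character_zeta (c : Zm * Zn -> k) :
  c 1%g = 1 -> {morph c : x y / (x * y)%g >-> x * y} ->
  exists (a : 'I_m) (b : 'I_n), forall x,
    c x = zeta m ^+ (a * cexp g1 x.1) * zeta n ^+ (b * cexp g2 x.2).
Proof.
move=> c1 cM.
have cX x i : c (x ^+ i)%g = c x ^+ i.
  by elim: i => [|i IH]; rewrite ?expgS ?cM ?IH ?exprS // c1.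
have [|a aE] := prim_rootP (zetaP m_gt0) (x := c (g1, 1%g)).
  by rewrite -cX expg_pair expg1n -cardsT expg_cardG ?inE.
have [|b bE] := prim_rootP (zetaP n_gt0) (x := c (1%g, g2)).
  by rewrite -cX expg_pair expg1n -cardsT expg_cardG ?inE.
exists a, b => -[x y] /=; rewrite !exprM -aE -bE -!cX -cM !expg_pair !expg1n.
by rewrite !cexpK //; congr (c (_, _)); rewrite ?mul1g ?mulg1.
Qed.

(** The cochain [u] is multiplicative in x, but in y only up to [xi ^+ m] at each carry. Its
    coboundary thus multiplies [zeta n ^+ b] by an m-th power of an n-th root of unity. *)
Lemma PhiABD_mod_gcd a b d :
  cohomologous (PhiABD a b d zetaP gen_g1 gen_g2)
               (PhiABD a (b %% gcdn m n) d zetaP gen_g1 gen_g2).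
Proof.
have zn : zeta n ^+ n = 1 := prim_expr_order (zetaP n_gt0).
have z0 : zeta n != 0.
  by apply: contra_eq_neq zn => ->; rewrite expr0n eqn0Ngt n_gt0 eq_sym oner_neq0.
(* Here t m is congruent to minus the gcd modulo n, so [xi ^+ m] cancels the part of b divisible by
   the gcd. *)
have [t _ /dvdnP[t' tE]] := Bezoutr m n_gt0.
pose xi := zeta n ^+ (b %/ gcdn m n * t).
have xi0 : xi != 0 by rewrite expf_neq0.
have xin : xi ^+ n = 1 by rewrite -exprM mulnC exprM zn expr1n.
have bE : zeta n ^+ b * xi ^+ m = zeta n ^+ (b %% gcdn m n).
  rewrite {1}(divn_eq b (gcdn m n)) exprD mulrAC -exprM -exprD -mulnA -mulnDr tE.
  by rewrite mulnA mulnC exprM zn expr1n mul1r.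
pose u (x y : Zm * Zn) := xi ^+ (cexp g2 x.2 * cexp g1 y.1).
unshelve eexists (@Cochain2 k (Zm * Zn)%type u _ _) => [x y|x|x y z /=].
- exact: expf_neq0.
- by rewrite /u /= !cexp1 // muln0.
rewrite /u /PhiABD_fun /= cexpM //.
have -> : xi ^+ ((cexp g2 x.2 + cexp g2 y.2) %% n * cexp g1 z.1) =
    xi ^+ ((cexp g2 x.2 + cexp g2 y.2) * cexp g1 z.1).
  by rewrite exprM (expr_mod _ xin) -exprM.
set q := ((_ + _) %/ m)%N; set j := cexp g2 x.2.
have qE : (cexp g1 z.1 + cexp g1 y.1 = q * m + cexp g1 (y.1 * z.1)%g)%N.
  by rewrite cexpM // [(cexp g1 y.1 + _)%N]addnC -divn_eq.
have -> : zeta n ^+ (b %% gcdn m n * q * j) =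
    zeta n ^+ (b * q * j) * xi ^+ (m * (q * j)).
  by rewrite -!mulnA !exprM -!exprMn -bE.
have -> : xi ^+ ((j + cexp g2 y.2) * cexp g1 z.1) * xi ^+ (j * cexp g1 y.1) =
    xi ^+ (j * (cexp g1 z.1 + cexp g1 y.1)) * xi ^+ (cexp g2 y.2 * cexp g1 z.1).
  by rewrite -!exprD mulnDl mulnDr addnAC.
rewrite qE mulnDr exprD [(q * m)%N]mulnC mulnCA [(j * q)%N]mulnC; ring.
Qed.

Lemma cocycle_cohomologous_PhiABD (Phi : cocycle3 k (Zm * Zn)%type) :
  exists (a : 'I_m) (b : 'I_(gcdn m n)) (d : 'I_n),
    cohomologous Phi (PhiABD a b d zetaP gen_g1 gen_g2).
Proof.
have [f1 [chi [coh1 chin f1E]]] := split_off_cyclic cyclic_factor2 Phi.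
have [d dE] := prim_rootP (zetaP n_gt0) chin.
pose D := PhiABD 0 0 d zetaP gen_g1 gen_g2.
have DE x y z : D x y z =
    chi ^+ (cexp g2 x.2 * ((cexp g2 y.2 + cexp g2 z.2) %/ n)).
  rewrite /= /PhiABD_fun !mul0n !expr0 !mul1r dE -exprM; congr (_ ^+ _).
  by rewrite -mulnA; congr (_ * _)%N; rewrite mulnC.
(* The d-part is divided out for the two reductions and multiplied back afterwards. *)
pose f2 := cocycle_mul f1 (cocycle_inv D).
have f2E x y z : f2 x y z = f1 x y (cf_base cyclic_factor2 z).
  have D0 := coc_neq0 D x y z.
  by rewrite -[LHS]/(f1 x y z / D x y z) f1E -DE mulfK.
have [|f3 coh3 f3E] := reduce_second (C := cyclic_factor2) (f := f2).
  by move=> x y z; rewrite !f2E cf_base_id.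
have [||f4 [c [coh4 c1 cM f4E]]] := reduce_third (C := cyclic_factor1) (f := f3).
(* Bases for the first factor lie in the second coordinate, which [f3] does not see in its last two
   arguments. *)
- by move=> x y z w; rewrite -f3E -[RHS]f3E /= mul1g.
- by move=> x y z w; rewrite -f3E -[RHS]f3E /= mul1g.
have [a [b cE]] := character_zeta c1 cM.
have gcd_gt0 : (0 < gcdn m n)%N by rewrite gcdn_gt0 m_gt0.
(* The character only gives b below n; its residue modulo the gcd is justified by
   [PhiABD_mod_gcd]. *)
exists a, (Ordinal (ltn_pmod b gcd_gt0)), d => /=.
apply: cohomologous_trans coh1 _.
apply: (@cohomologous_trans _ _ (cocycle_mul f2 D)).
  apply: cohomologous_eq => x y z.
  by rewrite -[RHS]/(f1 x y z / D x y z * D x y z) divfK ?coc_neq0.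
apply: (cohomologous_trans (cohomologous_mul D coh3)).
apply: (cohomologous_trans (cohomologous_mul D coh4)).
apply: cohomologous_trans (PhiABD_mod_gcd a b d).
apply: cohomologous_eq => x y z.
rewrite -[LHS]/(f4 x y z * D x y z) f4E DE cE dE /= /PhiABD_fun exprMn -!exprM.
by rewrite [(cexp g1 z.1 + _)%N]addnC; congr (_ ^+ _ * _ ^+ _ * _ ^+ _);
  rewrite -!mulnA; congr (_ * _)%N; rewrite mulnC.
Qed.

End ProductOfCyclic.

Theorem theorem4p1 (k : closedFieldType) (char0 : [pchar k] =i pred0)
    (zeta : nat -> k)
    (zetaP : forall s : nat, (0 < s)%N -> s.-primitive_root (zeta s))
    (m n : nat) (m_gt0 : (0 < m)%N) (n_gt0 : (0 < n)%N)
    (Zm Zn : finGroupType) (card_Zm : #|Zm| = m) (card_Zn : #|Zn| = n)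
    (g1 : Zm) (gen_g1 : generator [set: Zm] g1)
    (g2 : Zn) (gen_g2 : generator [set: Zn] g2)
    (Phi : cocycle3 k (Zm * Zn)%type) :
  exists (a : 'I_m) (b : 'I_(gcdn m n)) (d : 'I_n),
    tensor_equivalent (Vec Phi) (Vec (PhiABD a b d zetaP gen_g1 gen_g2)).
Proof.
subst m n.
have [a [b [d coh]]] := cocycle_cohomologous_PhiABD gen_g1 gen_g2 zetaP Phi.
by exists a, b, d; apply: cohomologous_tensor_equivalent.
Qed.
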